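(* Let $A$ be a ring, let $\mathfrak{C}$ be an $A$-coring, and let $\Sigma$ be a right $\mathfrak{C}$-comodule that is finitely generated and projective as a right $A$-module. If ${}_A\mathfrak{C}$ is flat, then $(\mathfrak{C},\Sigma)$ is Galois if and only if there exists an exact sequence $\Sigma^{(J)}\to\Sigma^{(I)}\to\mathfrak{C}\to0$ in the category $\mathcal{M}^{\mathfrak{C}}$ of right $\mathfrak{C}$-comodules (for some sets $I,J$) such that the sequence $$\mathrm{Hom}_{\mathfrak{C}}(\Sigma,\Sigma^{(J)})\to\mathrm{Hom}_{\mathfrak{C}}(\Sigma,\Sigma^{(I)})\to\mathrm{Hom}_{\mathfrak{C}}(\Sigma,\mathfrak{C})\to0$$ is exact.
   Context: All rings are associative unital algebras over a fixed commutative ring $K$, and bimodules are centralized by $K$. An $A$-coring is an $A$-bimodule $\mathfrak{C}$ with $A$-bimodule maps $\Delta:\mathfrak{C}\to\mathfrak{C}\otimes_A\mathfrak{C}$ and $\epsilon:\mathfrak{C}\to A$ that are coassociative and counital. A right $\mathfrak{C}$-comodule is a right $A$-module $M$ with a right $A$-linear coassociative and counital coaction $\rho_M:M\to M\otimes_A\mathfrak{C}$; $\mathrm{Hom}_{\mathfrak{C}}(M,N)$ is the set of right $A$-linear maps commuting with the coactions. $\mathfrak{C}$ is a right comodule over itself via $\Delta$. If ${}_A\mathfrak{C}$ is flat, $\mathcal{M}^{\mathfrak{C}}$ is a Grothendieck category. $\Sigma^{(I)}$ denotes the direct sum of copies of $\Sigma$ indexed by $I$. Let $\Sigma^*=\mathrm{Hom}_A(\Sigma,A)$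 and $T=\mathrm{End}_{\mathfrak{C}}(\Sigma)$ (comodule endomorphisms, product is composition). With a finite dual basis $\{(e_i^*,e_i)\}$ of $\Sigma_A$, the $A$-bimodule $\Sigma^*\otimes_T\Sigma$ is an $A$-coring via $\Delta(\phi\otimes_Tx)=\sum_i\phi\otimes_Te_i\otimes_Ae_i^*\otimes_Tx$, $\epsilon(\phi\otimes_Tx)=\phi(x)$. The canonical map $\mathsf{can}:\Sigma^*\otimes_T\Sigma\to\mathfrak{C}$, $\mathsf{can}(\phi\otimes_Tx)=\sum\phi(x_0)x_1$, where $\rho_\Sigma(x)=\sum x_0\otimes_Ax_1$, is a homomorphism of $A$-corings. The pair $(\mathfrak{C},\Sigma)$ is called Galois if $\mathsf{can}$ is an isomorphism. *)

(* Defs.v *)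
From HB Require Import structures.
From mathcomp Require Import all_boot all_algebra.
From mathcomp Require Import generic_quotient finmap boolp.

Set Implicit Arguments.
Unset Strict Implicit.
Unset Printing Implicit Defensive.

Import GRing.Theory.
Local Open Scope ring_scope.
Local Open Scope quotient_scope.

(* Tensor products.  [ra] and [la] are the right and left actions of the      *)
(* scalars [R] on [M] and [N].  An element of the tensor product is a formal  *)
(* sum of pairs, two formal sums being identified when no balanced map tells  *)
(* them apart; [tliftE] and [tens_ext] below are the universal property.      *)
Section Tensor.
Variables (R : Type) (M N : zmodType) (ra : M -> R -> M) (la : R -> N -> N).

Definition balanced (G : zmodType) (f : M -> N -> G) : Prop :=
  [/\ forall m m' n, f (m + m') n = f m n + f m' n,
      forall m n n', f m (n + n') = f m n + f m n'
    & forall m r n, f (ra m r) n = f m (la r n)].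

Definition tsum (G : zmodType) (f : M -> N -> G) (s : seq (M * N)) : G :=
  \sum_(p <- s) f p.1 p.2.

Definition teqv (s t : seq (M * N)) : bool :=
  `[< forall (G : zmodType) (f : M -> N -> G),
        balanced f -> tsum f s = tsum f t >].

Lemma teqv_is_equiv : equiv_class_of teqv.
Proof.
split.
- by move=> s; apply/asboolP.
- by move=> s t; apply/asboolP/asboolP => h G f bf; rewrite h.
- by move=> t s u /asboolP h /asboolP h'; apply/asboolP => G f bf; rewrite h ?h'.
Qed.

Canonical teqv_equiv := EquivRelPack teqv_is_equiv.

Definition tens : Type := {eq_quot teqv_equiv}.

HB.instance Definition _ := Choice.on tens.
HB.instance Definition _ := EqQuotient.on tens.

(* [tlift f] is the additive map induced by [f]; it is only meaningful when   *)
(* [f] is balanced.                                                           *)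
Definition tlift (G : zmodType) (f : M -> N -> G) : tens -> G :=
  locked (fun x => tsum f (repr x)).

Definition tpure (m : M) (n : N) : tens := \pi_tens [:: (m, n)].

Lemma tens_eqP (s t : seq (M * N)) :
  (forall (G : zmodType) (f : M -> N -> G), balanced f ->
     tsum f s = tsum f t) -> \pi_tens s = \pi_tens t.
Proof. by move=> h; apply/eqmodP/asboolP. Qed.

Lemma tsum_repr (G : zmodType) (f : M -> N -> G) s : balanced f ->
  tsum f (repr (\pi_tens s)) = tsum f s.
Proof.
move=> bf; have /eqmodP/asboolP h : \pi_tens (repr (\pi_tens s)) = \pi_tens s.
  by rewrite reprK.
exact: h.
Qed.

Definition tzero : tens := \pi_tens [::].
Definition tadd (x y : tens) : tens := \pi_tens (repr x ++ repr y).
Definition topp (x : tens) : tens := \pi_tens [seq (- p.1, p.2) | p <- repr x].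

Lemma tsum_cat (G : zmodType) (f : M -> N -> G) s t :
  tsum f (s ++ t) = tsum f s + tsum f t.
Proof. by rewrite /tsum big_cat. Qed.

Lemma balanced0l (G : zmodType) (f : M -> N -> G) n : balanced f -> f 0 n = 0.
Proof. by case=> h _ _; apply: (addrI (f 0 n)); rewrite -h !addr0. Qed.

Lemma balancedNl (G : zmodType) (f : M -> N -> G) m n :
  balanced f -> f (- m) n = - f m n.
Proof.
move=> bf; apply: (addrI (f m n)); rewrite subrr.
by case: (bf) => <- _ _; rewrite subrr balanced0l.
Qed.

Lemma tsum_opp (G : zmodType) (f : M -> N -> G) s : balanced f ->
  tsum f [seq (- p.1, p.2) | p <- s] = - tsum f s.
Proof.
move=> bf; rewrite /tsum big_map -sumrN; apply: eq_bigr => p _ /=.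
exact: balancedNl.
Qed.

Lemma taddA : associative tadd.
Proof.
by move=> x y z; apply: tens_eqP => G f bf; rewrite !(tsum_cat, tsum_repr) // addrA.
Qed.
Lemma taddC : commutative tadd.
Proof. by move=> x y; apply: tens_eqP => G f bf; rewrite !tsum_cat addrC. Qed.
Lemma tadd0 : left_id tzero tadd.
Proof.
move=> x; rewrite -[RHS]reprK; apply: tens_eqP => G f bf.
by rewrite !(tsum_cat, tsum_repr) // /tsum big_nil add0r.
Qed.
Lemma taddN : left_inverse tzero topp tadd.
Proof.
move=> x; apply: tens_eqP => G f bf.
by rewrite !(tsum_cat, tsum_repr, tsum_opp) // addNr /tsum big_nil.
Qed.

HB.instance Definition _ := GRing.isZmodule.Build tens taddA taddC tadd0 taddN.

Lemma tliftD (G : zmodType) (f : M -> N -> G) : balanced f ->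
  {morph tlift f : x y / x + y}.
Proof. by move=> bf x y; rewrite /tlift -lock tsum_repr // tsum_cat. Qed.

Lemma tliftE (G : zmodType) (f : M -> N -> G) m n : balanced f ->
  tlift f (tpure m n) = f m n.
Proof. by move=> bf; rewrite /tlift -lock tsum_repr // /tsum big_seq1. Qed.

Lemma tpure_balanced : balanced tpure.
Proof.
split=> [m m' n|m n n'|m r n]; apply: tens_eqP => G f bf;
  rewrite ?tsum_cat ?tsum_repr // /tsum !big_seq1 /=; by case: bf.
Qed.

Lemma tens_ind (P : tens -> Prop) :
  P 0 -> (forall m n, P (tpure m n)) -> (forall x y, P x -> P y -> P (x + y)) ->
  forall x, P x.
Proof.
move=> P0 P1 PD x; rewrite -[x]reprK; elim: (repr x) => [|[m n] s IH] //.
suff -> : \pi_tens ((m, n) :: s) = tpure m n + \pi_tens s by apply: PD.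
apply: tens_eqP => G f bf.
by rewrite !(tsum_cat, tsum_repr) // /tsum big_seq1 big_cons.
Qed.

End Tensor.

(* Unfolding these types makes unification up to canonical structures diverge. *)
Global Opaque tens.

Lemma morphD0 (U V : zmodType) (f : U -> V) : {morph f : x y / x + y} -> f 0 = 0.
Proof. by move=> h; apply: (addrI (f 0)); rewrite -h !addr0. Qed.

Lemma tens_ext (R : Type) (M N : zmodType) (ra : M -> R -> M)
    (la : R -> N -> N) (G : zmodType) (f g : tens ra la -> G) :
  {morph f : x y / x + y} -> {morph g : x y / x + y} ->
  (forall m n, f (tpure ra la m n) = g (tpure ra la m n)) -> f =1 g.
Proof.
move=> fD gD h; apply: tens_ind => // [|x y]; first by rewrite !morphD0.
by rewrite fD gD => -> ->.
Qed.

(* Right modules over [A] are modules over the converse ring [A^c], so that   *)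
(* [A] as a right module over itself is [(A^c)^o].                            *)
Notation "x *r a" := ((a : GRing.converse _) *: x)
  (at level 40, left associativity, only parsing) : ring_scope.

(* A [K]-algebra structure on [A]; unlike [algType K] this allows [A] to be   *)
(* the zero ring.                                                             *)
Record alg_struct (K : comPzRingType) (A : pzRingType) := AlgStruct {
  alg_map :> {rmorphism K -> A};
  alg_central : forall k a, alg_map k * a = a * alg_map k
}.

HB.mixin Record isBimodule (K : comPzRingType) (A : pzRingType) (eta : alg_struct K A) V
    of GRing.Lmodule A^c V := {
  lact : A -> V -> V;
  lactDr : forall a, {morph lact a : x y / x + y};
  lactDl : forall x, {morph (lact^~ x) : a b / a + b};
  lactA : forall a b x, lact a (lact b x) = lact (a * b) x;
  lact1 : forall x, lact 1 x = x;
  lact_ract : forall a x b, lact a x *r b = lact a (x *r b);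
  lact_central : forall k x, lact (eta k) x = x *r eta k
}.

#[short(type="bimodType")]
HB.structure Definition Bimodule (K : comPzRingType) (A : pzRingType) (eta : alg_struct K A) :=
  { V of isBimodule K A eta V & GRing.Lmodule A^c V }.

Notation "a *l x" := (lact a x)
  (at level 40, left associativity) : ring_scope.

Lemma eq_linear (R : pzRingType) (U V : lmodType R) (f g : {linear U -> V}) :
  f =1 g -> f = g.
Proof.
case: f g => f [[f1] [f2]] [g [[g1] [g2]]] /= /funext efg; rewrite {}efg in f1 f2 *.
by rewrite (Prop_irrelevance f1 g1) (Prop_irrelevance f2 g2).
Qed.

Section LinearZmodule.
Variables (R : pzRingType) (U V : lmodType R).

HB.instance Definition _ := gen_eqMixin {linear U -> V}.
HB.instance Definition _ := gen_choiceMixin {linear U -> V}.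

Definition lin_zero : {linear U -> V} := \0.
Definition lin_opp (f : {linear U -> V}) : {linear U -> V} := \- f.
Definition lin_add (f g : {linear U -> V}) : {linear U -> V} := f \+ g.

Fact lin_addA : associative lin_add.
Proof. by move=> f g h; apply: eq_linear => x /=; rewrite addrA. Qed.
Fact lin_addC : commutative lin_add.
Proof. by move=> f g; apply: eq_linear => x /=; rewrite addrC. Qed.
Fact lin_add0 : left_id lin_zero lin_add.
Proof. by move=> f; apply: eq_linear => x /=; rewrite add0r. Qed.
Fact lin_addN : left_inverse lin_zero lin_opp lin_add.
Proof. by move=> f; apply: eq_linear => x /=; rewrite addNr. Qed.

HB.instance Definition _ := GRing.isZmodule.Build {linear U -> V}
  lin_addA lin_addC lin_add0 lin_addN.

End LinearZmodule.

(* [M (x)_A C] for a right module [M] and a bimodule [C]. *)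
Section TensorA.
Variables (K : comPzRingType) (A : pzRingType) (eta : alg_struct K A).

Definition tensA (M : lmodType A^c) (C : bimodType eta) : Type :=
  tens (fun (m : M) (a : A) => m *r a) (fun (a : A) (c : C) => a *l c).

HB.instance Definition _ (M : lmodType A^c) (C : bimodType eta) :=
  GRing.Zmodule.on (tensA M C).

Definition pureA (M : lmodType A^c) (C : bimodType eta) (m : M) (c : C)
  : tensA M C := tpure _ _ m c.

Definition balancedA (M : lmodType A^c) (C : bimodType eta) (G : zmodType)
    (f : M -> C -> G) : Prop :=
  balanced (fun (m : M) (a : A) => m *r a) (fun (a : A) (c : C) => a *l c) f.

Lemma pureA_balanced (M : lmodType A^c) (C : bimodType eta) :
  balancedA (@pureA M C).
Proof. exact: tpure_balanced. Qed.

Lemma pureADl (M : lmodType A^c) (C : bimodType eta) (m m' : M) (c : C) :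
  pureA (m + m') c = pureA m c + pureA m' c.
Proof. by case: (@pureA_balanced M C) => h _ _; apply: h. Qed.
Lemma pureADr (M : lmodType A^c) (C : bimodType eta) (m : M) (c c' : C) :
  pureA m (c + c') = pureA m c + pureA m c'.
Proof. by case: (@pureA_balanced M C) => _ h _; apply: h. Qed.
Lemma pureA_mid (M : lmodType A^c) (C : bimodType eta) (m : M) (a : A) (c : C) :
  pureA (m *r a) c = pureA m (a *l c).
Proof. by case: (@pureA_balanced M C) => _ _; apply. Qed.

Definition tliftA (M : lmodType A^c) (C : bimodType eta) (G : zmodType)
  (f : M -> C -> G) : tensA M C -> G := @tlift _ _ _ _ _ G f.

Lemma tliftAD (M : lmodType A^c) (C : bimodType eta) (G : zmodType)
    (f : M -> C -> G) : balancedA f -> {morph tliftA f : x y / x + y}.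
Proof. exact: tliftD. Qed.

Lemma tliftAE (M : lmodType A^c) (C : bimodType eta) (G : zmodType)
    (f : M -> C -> G) m c : balancedA f -> tliftA f (pureA m c) = f m c.
Proof. exact: tliftE. Qed.

Lemma tensA_ind (M : lmodType A^c) (C : bimodType eta) (P : tensA M C -> Prop) :
  P 0 -> (forall m c, P (pureA m c)) -> (forall x y, P x -> P y -> P (x + y)) ->
  forall x, P x.
Proof. exact: tens_ind. Qed.

Lemma tensA_ext (M : lmodType A^c) (C : bimodType eta) (G : zmodType)
    (f g : tensA M C -> G) :
  {morph f : x y / x + y} -> {morph g : x y / x + y} ->
  (forall m c, f (pureA m c) = g (pureA m c)) -> f =1 g.
Proof. exact: tens_ext. Qed.

Global Opaque tensA.

Section RightAction.
Variables (M : lmodType A^c) (C : bimodType eta).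

Definition tract (a : A^c) : tensA M C -> tensA M C :=
  tliftA (fun m c => pureA m (c *r a)).

Lemma tract_balanced a : balancedA (fun (m : M) (c : C) => pureA m (c *r a)).
Proof.
split=> [m m' c|m c c'|m r c]; first exact: pureADl.
  by rewrite scalerDr pureADr.
by rewrite pureA_mid lact_ract.
Qed.

Lemma tractE a m c : tract a (pureA m c) = pureA m (c *r a).
Proof. exact: tliftAE (tract_balanced a). Qed.

Lemma tractD a : {morph tract a : x y / x + y}.
Proof. exact: tliftAD (tract_balanced a). Qed.

Fact tractA a b x : tract a (tract b x) = tract (a * b) x.
Proof.
move: x; apply: tensA_ext => [x y|x y|m c]; rewrite ?tractD //.
by rewrite !tractE scalerA.
Qed.
Fact tract1 : left_id 1 tract.
Proof.
by apply: tensA_ext => [x y|x y|m c]; rewrite ?tractD // tractE scale1r.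
Qed.
Fact tractDl x : {morph tract^~ x : a b / a + b}.
Proof.
move=> a b; move: x; apply: tensA_ext => [x y|x y|m c]; rewrite ?tractD //.
  by rewrite addrACA.
by rewrite !tractE scalerDl pureADr.
Qed.

HB.instance Definition _ := GRing.Zmodule_isLmodule.Build A^c (tensA M C)
  tractA tract1 tractD tractDl.

Lemma pureA_ract (m : M) (c : C) (a : A) : pureA m c *r a = pureA m (c *r a).
Proof. exact: tractE. Qed.

End RightAction.

Section LeftAction.
Variables (M C : bimodType eta).

Definition tleft (a : A) : tensA M C -> tensA M C :=
  tliftA (fun m c => pureA (a *l m) c).

Lemma tleft_balanced a : balancedA (fun (m : M) (c : C) => pureA (a *l m) c).
Proof.
split=> [m m' c|m c c'|m r c]; [by rewrite lactDr pureADl|exact: pureADr|].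
by rewrite -lact_ract pureA_mid.
Qed.

Lemma tleftE a m c : tleft a (pureA m c) = pureA (a *l m) c.
Proof. exact: tliftAE (tleft_balanced a). Qed.

Fact tleftD a : {morph tleft a : x y / x + y}.
Proof. exact: tliftAD (tleft_balanced a). Qed.
Fact tleftDl x : {morph tleft^~ x : a b / a + b}.
Proof.
move=> a b; move: x; apply: tensA_ext => [x y|x y|m c]; rewrite ?tleftD //.
  by rewrite addrACA.
by rewrite !tleftE lactDl pureADl.
Qed.
Fact tleftA a b x : tleft a (tleft b x) = tleft (a * b) x.
Proof.
move: x; apply: tensA_ext => [x y|x y|m c]; rewrite ?tleftD //.
by rewrite !tleftE lactA.
Qed.
Fact tleft1 x : tleft 1 x = x.
Proof.
by move: x; apply: tensA_ext => [x y|x y|m c]; rewrite ?tleftD // tleftE lact1.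
Qed.
Fact tleft_ract a x b : tleft a x *r b = tleft a (x *r b).
Proof.
move: x; apply: tensA_ext => [x y|x y|m c]; rewrite ?(tleftD, scalerDr) //.
by rewrite !(tleftE, pureA_ract).
Qed.
Fact tleft_central k x : tleft (eta k) x = x *r eta k.
Proof.
move: x; apply: tensA_ext => [x y|x y|m c]; rewrite ?(tleftD, scalerDr) //.
by rewrite !(tleftE, pureA_ract) lact_central pureA_mid lact_central.
Qed.

HB.instance Definition _ := isBimodule.Build K A eta (tensA M C)
  tleftD tleftDl tleftA tleft1 tleft_ract tleft_central.

Lemma lact_pureA (a : A) (m : M) (c : C) : a *l pureA m c = pureA (a *l m) c.
Proof. exact: tleftE. Qed.

End LeftAction.

Section Maps.
Variables (M N : lmodType A^c) (C D : bimodType eta).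

Definition tmap (f : M -> N) (g : C -> D) : tensA M C -> tensA N D :=
  tliftA (fun m c => pureA (f m) (g c)).

Lemma tmap_balanced (f : {linear M -> N}) (g : C -> D) :
  {morph g : x y / x + y} -> (forall a c, g (a *l c) = a *l g c) ->
  balancedA (fun m c => pureA (f m) (g c)).
Proof.
move=> gD gl; split=> [m m' c|m c c'|m r c].
- by rewrite linearD pureADl.
- by rewrite gD pureADr.
- by rewrite linearZ pureA_mid gl.
Qed.

Lemma tmap_id_balanced (f : {linear M -> N}) :
  balancedA (fun (m : M) (c : C) => pureA (f m) c).
Proof.
split=> [m m' c|m c c'|m r c]; last by rewrite linearZ pureA_mid.
  by rewrite linearD pureADl.
by rewrite pureADr.
Qed.

End Maps.

Section MapTheory.
Variables (M N : lmodType A^c) (C D : bimodType eta).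

Lemma tmapD (f : {linear M -> N}) (g : C -> D) :
  {morph g : x y / x + y} -> (forall a c, g (a *l c) = a *l g c) ->
  {morph tmap f g : x y / x + y}.
Proof. by move=> gD gl; apply: tliftAD; apply: tmap_balanced. Qed.

Lemma tmapE (f : {linear M -> N}) (g : C -> D) (m : M) (c : C) :
  {morph g : x y / x + y} -> (forall a c, g (a *l c) = a *l g c) ->
  tmap f g (pureA m c) = pureA (f m) (g c).
Proof. by move=> gD gl; rewrite /tmap tliftAE //; apply: tmap_balanced. Qed.

Lemma tmap_idD (f : {linear M -> N}) :
  {morph (tmap f id : tensA M C -> tensA N C) : x y / x + y}.
Proof. exact: tliftAD (tmap_id_balanced C f). Qed.

Lemma tmap_idE (f : {linear M -> N}) (m : M) (c : C) :
  tmap f id (pureA m c) = pureA (f m) c.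
Proof. exact: tliftAE (tmap_id_balanced C f). Qed.

Lemma id_tmapD (g : C -> D) :
  {morph g : x y / x + y} -> (forall a c, g (a *l c) = a *l g c) ->
  {morph (tmap id g : tensA M C -> tensA M D) : x y / x + y}.
Proof.
by move=> gD gl; apply: tliftAD; apply: (tmap_balanced (idfun : {linear M -> M})).
Qed.

Lemma id_tmapE (g : C -> D) (m : M) (c : C) :
  {morph g : x y / x + y} -> (forall a c, g (a *l c) = a *l g c) ->
  tmap id g (pureA m c) = pureA m (g c).
Proof.
move=> gD gl; rewrite /tmap tliftAE //.
exact: (tmap_balanced (idfun : {linear M -> M})).
Qed.

End MapTheory.

(* [(m (x) c) (x) d |-> m (x) (c (x) d)] *)
Section Assoc.
Variables (M : lmodType A^c) (C D : bimodType eta).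

Definition tassoc_at (d : D) : tensA M C -> tensA M (tensA C D) :=
  tliftA (fun m c => pureA m (pureA c d)).

Definition tassoc : tensA (tensA M C) D -> tensA M (tensA C D) :=
  tliftA (fun x d => tassoc_at d x).

Lemma tassoc_at_balanced (d : D) :
  balancedA (fun (m : M) (c : C) => pureA m (pureA c d)).
Proof.
split=> [m m' c|m c c'|m r c]; first exact: pureADl.
  by rewrite pureADl pureADr.
by rewrite pureA_mid lact_pureA.
Qed.

Lemma tassoc_atE (m : M) (c : C) (d : D) : tassoc_at d (pureA m c) = pureA m (pureA c d).
Proof. exact: tliftAE (tassoc_at_balanced d). Qed.

Lemma tassoc_balanced :
  balancedA (fun (x : tensA M C) (d : D) => tassoc_at d x).
Proof.
have tD d : {morph tassoc_at d : x y / x + y}.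
  exact: tliftAD (tassoc_at_balanced d).
split=> [x y d|x d d'|x r d]; first exact: tD.
  move: x; apply: tensA_ext => [x y|x y|m c]; rewrite ?tD //.
    by rewrite addrACA.
  by rewrite !tassoc_atE !pureADr.
move: x; apply: tensA_ext => [x y|x y|m c]; rewrite ?(tD, scalerDr) //.
by rewrite pureA_ract !tassoc_atE pureA_mid.
Qed.

Lemma tassocE (m : M) (c : C) (d : D) : tassoc (pureA (pureA m c) d) = pureA m (pureA c d).
Proof. by rewrite /tassoc tliftAE ?tassoc_atE //; apply: tassoc_balanced. Qed.

Lemma tassocD : {morph tassoc : x y / x + y}.
Proof. exact: tliftAD tassoc_balanced. Qed.

End Assoc.

End TensorA.

Section FinitelyGeneratedProjective.
Variables (A : pzRingType) (M : lmodType A^c).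

Definition fin_gen : Prop :=
  exists n (e : 'I_n -> M), forall x, exists a : 'I_n -> A,
    x = \sum_i e i *r (a i : A).

Definition projective : Prop :=
  forall (U V : lmodType A^c) (p : {linear U -> V}) (f : {linear M -> V}),
    (forall v, exists u, p u = v) ->
    exists g : {linear M -> U}, forall x, p (g x) = f x.

(* Being right [A]-linear, elements of [rdual] satisfy [phi (x *r a) = phi x * a], *)
(* the product being that of [A].                                            *)
Definition rdual : Type := {linear M -> (A^c)^o}.
HB.instance Definition _ := GRing.Zmodule.on rdual.

Definition ev (phi : rdual) (x : M) : A := (phi : {linear M -> (A^c)^o}) x.

Record dual_basis := DualBasis {
  db_size : nat;
  db_vec : 'I_db_size -> M;
  db_form : 'I_db_size -> rdual;
  db_eq : forall x, x = \sum_i db_vec i *r (ev (db_form i) x)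
}.

Lemma evDr (phi : rdual) : {morph ev phi : x y / x + y}.
Proof. by move=> x y; rewrite /ev linearD. Qed.
Lemma ev_ract (phi : rdual) x a : ev phi (x *r a) = ev phi x * a.
Proof. by rewrite /ev linearZ. Qed.
Lemma evDl (phi psi : rdual) x : ev (phi + psi) x = ev phi x + ev psi x.
Proof. by []. Qed.

Lemma fgp_dual_basis : fin_gen -> projective -> exists d : dual_basis, True.
Proof.
move=> [n [e genM]] projM.
pose p (a : {ffun 'I_n -> (A^c)^o}) : M := \sum_i e i *r (a i : A).
have pD : {morph p : x y / x + y}.
  move=> x y; rewrite /p -big_split; apply: eq_bigr => i _.
  by rewrite ffunE scalerDl.
have pZ : scalable p.
  move=> a x; rewrite /p scaler_sumr; apply: eq_bigr => i _.
  by rewrite ffunE scalerA.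
pose pA := GRing.isNmodMorphism.Build _ _ p (morphD0 pD, pD).
pose pS := GRing.isScalable.Build A^c _ _ *:%R p pZ.
pose pL : {linear _ -> _} := HB.pack p pA pS.
have [|g gK] := projM _ _ pL idfun.
  move=> x; have [a ->] := genM x; exists [ffun i => a i].
  by apply: eq_bigr => i _; rewrite ffunE.
have phiD i : {morph (fun x => g x i) : x y / x + y}.
  by move=> x y; rewrite linearD ffunE.
have phiZ i : scalable (fun x => g x i : (A^c)^o).
  by move=> a x; rewrite linearZ ffunE.
pose phiA i := GRing.isNmodMorphism.Build M (A^c)^o (fun x => g x i)
  (morphD0 (phiD i), phiD i).
pose phiS i := GRing.isScalable.Build A^c M (A^c)^o *:%R (fun x => g x i) (phiZ i).
pose phi i : {linear M -> (A^c)^o} := HB.pack (fun x => g x i) (phiA i) (phiS i).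
by exists (@DualBasis n e phi (fun x => esym (gK x))).
Qed.

End FinitelyGeneratedProjective.

Definition flat_left (K : comPzRingType) (A : pzRingType) (eta : alg_struct K A)
    (C : bimodType eta) : Prop :=
  forall (M N : lmodType A^c) (f : {linear M -> N}),
    injective f -> injective (tmap f id : tensA M C -> tensA N C).

Record coring (K : comPzRingType) (A : pzRingType) (eta : alg_struct K A) := Coring {
  coring_bimod :> bimodType eta;
  comult : {linear coring_bimod -> tensA coring_bimod coring_bimod};
  counit : {linear coring_bimod -> (A^c)^o};
  comult_lact : forall (a : A) c, comult (a *l c) = a *l comult c;
  counit_lact : forall (a : A) c, counit (a *l c) = a * (counit c : A);
  comultA : forall c,
    tassoc (tmap comult id (comult c)) = tmap id comult (comult c);
  counitl : forall c, 
    tliftA (fun x y : coring_bimod => (counit x : A) *l y) (comult c) = c;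
  counitr : forall c, 
    tliftA (fun x y : coring_bimod => x *r (counit y : A)) (comult c) = c
}.

Record coring_hom (K : comPzRingType) (A : pzRingType) (eta : alg_struct K A)
    (C D : coring eta) (f : C -> D) : Prop := CoringHom {
  coring_homD : {morph f : x y / x + y};
  coring_homl : forall (a : A) c, f (a *l c) = a *l f c;
  coring_homr : forall (a : A) c, f (c *r a) = f c *r a;
  coring_hom_comult : forall c, comult D (f c) = tmap f f (comult C c);
  coring_hom_counit : forall c, counit D (f c) = counit C c
}.

Definition coring_iso (K : comPzRingType) (A : pzRingType) (eta : alg_struct K A)
    (C D : coring eta) (f : C -> D) : Prop :=
  coring_hom f /\
  exists g : D -> C, [/\ coring_hom g, cancel f g & cancel g f].

Record comodule (K : comPzRingType) (A : pzRingType) (eta : alg_struct K A)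
    (C : coring eta) := Comodule {
  comod_mod :> lmodType A^c;
  coact : {linear comod_mod -> tensA comod_mod C};
  coactA : forall m, tassoc (tmap coact id (coact m)) = tmap id (comult C) (coact m);
  coact1 : forall m, 
    tliftA (fun (x : comod_mod) (c : C) => x *r (counit C c : A)) (coact m) = m
}.

Section Comodules.
Variables (K : comPzRingType) (A : pzRingType) (eta : alg_struct K A) (C : coring eta).
Implicit Types X Y Z : comodule C.

Definition coring_comod : comodule C := Comodule (@comultA _ _ _ C) (@counitr _ _ _ C).

Record comod_hom X Y := ComodHom {
  comod_fun :> {linear X -> Y};
  comod_funP : forall x, coact Y (comod_fun x) = tmap comod_fun id (coact X x)
}.

Lemma tmap_id_comp X Y Z (f : {linear X -> Y}) (g : {linear Y -> Z})
    (u : tensA X C) :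
  tmap g id (tmap f id u) = tmap (g \o f) id u :> tensA Z C.
Proof.
move: u; apply: tensA_ext => [x y|x y|x c]; rewrite ?tmap_idD //.
by rewrite !tmap_idE.
Qed.

Fact comod_compP X Y Z (g : comod_hom Y Z) (f : comod_hom X Y) x :
  coact Z ((g \o f) x) = tmap (g \o f) id (coact X x).
Proof. by rewrite /= comod_funP comod_funP tmap_id_comp. Qed.

Definition comod_comp X Y Z (g : comod_hom Y Z) (f : comod_hom X Y) : comod_hom X Z :=
  @ComodHom X Z (g \o f) (comod_compP g f).

End Comodules.


Lemma morph_sum (U V : zmodType) (f : U -> V) (I : Type) (r : seq I) (F : I -> U) :
  {morph f : x y / x + y} -> f (\sum_(i <- r) F i) = \sum_(i <- r) f (F i).
Proof. by move=> fD; apply: (big_morph f fD (morphD0 fD)). Qed.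

Section Comatrix.
Variables (K : comPzRingType) (A : pzRingType) (eta : alg_struct K A).
Variables (C : coring eta) (S : comodule C).

(* The ring [T = End_C(S)], of which only the actions on [S] and on its dual  *)
(* enter the tensor product [S^* (x)_T S].                                    *)
Definition endo : Type := comod_hom S S.

Definition rdual_endo (phi : rdual S) (t : endo) : rdual S :=
  (phi : {linear S -> (A^c)^o}) \o t.

Definition endo_app (t : endo) (x : S) : S := t x.

Definition comatrix : Type := tens rdual_endo endo_app.
HB.instance Definition _ := GRing.Zmodule.on comatrix.

Definition cpure (phi : rdual S) (x : S) : comatrix := tpure _ _ phi x.

Definition clift (G : zmodType) (f : rdual S -> S -> G) : comatrix -> G :=
  @tlift _ _ _ _ _ G f.

Definition cbalanced (G : zmodType) (f : rdual S -> S -> G) : Prop :=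
  balanced rdual_endo endo_app f.

Lemma cpure_balanced : cbalanced cpure.
Proof. exact: tpure_balanced. Qed.

Lemma cpureDl phi psi x : cpure (phi + psi) x = cpure phi x + cpure psi x.
Proof. by case: cpure_balanced => h _ _; apply: h. Qed.
Lemma cpureDr phi x y : cpure phi (x + y) = cpure phi x + cpure phi y.
Proof. by case: cpure_balanced => _ h _; apply: h. Qed.
Lemma cpure_mid phi (t : endo) x : cpure (rdual_endo phi t) x = cpure phi (t x).
Proof. by case: cpure_balanced => _ _ h; apply: h. Qed.

Lemma cliftE (G : zmodType) (f : rdual S -> S -> G) phi x :
  cbalanced f -> clift f (cpure phi x) = f phi x.
Proof. exact: tliftE. Qed.

Lemma cliftD (G : zmodType) (f : rdual S -> S -> G) :
  cbalanced f -> {morph clift f : x y / x + y}.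
Proof. exact: tliftD. Qed.

Lemma comatrix_ext (G : zmodType) (f g : comatrix -> G) :
  {morph f : x y / x + y} -> {morph g : x y / x + y} ->
  (forall phi x, f (cpure phi x) = g (cpure phi x)) -> f =1 g.
Proof. exact: tens_ext. Qed.

Definition ldual_fun (a : A) (phi : rdual S) (x : S) : (A^c)^o := a * ev phi x.

Fact ldual_linear (a : A) (phi : rdual S) : linear (ldual_fun a phi).
Proof. by move=> b x y; rewrite /ldual_fun evDr ev_ract mulrDr mulrA. Qed.

HB.instance Definition _ (a : A) (phi : rdual S) :=
  GRing.isLinear.Build A^c S (A^c)^o *:%R (ldual_fun a phi)
    (ldual_linear a phi).

Definition ldual (a : A) (phi : rdual S) : rdual S :=
  ldual_fun a phi : {linear S -> (A^c)^o}.

Lemma ev_ldual a phi x : ev (ldual a phi) x = a * ev phi x.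
Proof. by []. Qed.

Lemma rdualP (phi psi : rdual S) : ev phi =1 ev psi -> phi = psi.
Proof. by move=> h; apply: (@eq_linear A^c S (A^c)^o). Qed.

Definition cract (a : A^c) : comatrix -> comatrix :=
  clift (fun phi x => cpure phi (x *r a)).

Definition cleft (a : A) : comatrix -> comatrix :=
  clift (fun phi x => cpure (ldual a phi) x).

Lemma cract_balanced (a : A^c) : cbalanced (fun phi x => cpure phi (x *r a)).
Proof.
split=> [phi psi x|phi x y|phi t x]; first exact: cpureDl.
  by rewrite scalerDr cpureDr.
by rewrite cpure_mid /endo_app linearZ.
Qed.

Lemma cleft_balanced a : cbalanced (fun phi x => cpure (ldual a phi) x).
Proof.
split=> [phi psi x|phi x y|phi t x]; last first.
- by rewrite -cpure_mid; congr cpure; apply: rdualP.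
- exact: cpureDr.
- rewrite -cpureDl; congr cpure; apply: rdualP => y.
  by rewrite evDl !ev_ldual evDl mulrDr.
Qed.

Lemma cractE a phi x : cract a (cpure phi x) = cpure phi (x *r a).
Proof. exact: cliftE (cract_balanced a). Qed.
Lemma cractD a : {morph cract a : x y / x + y}.
Proof. exact: cliftD (cract_balanced a). Qed.
Lemma cleftE a phi x : cleft a (cpure phi x) = cpure (ldual a phi) x.
Proof. exact: cliftE (cleft_balanced a). Qed.
Lemma cleftD a : {morph cleft a : x y / x + y}.
Proof. exact: cliftD (cleft_balanced a). Qed.

Fact cractA a b u : cract a (cract b u) = cract (a * b) u.
Proof.
move: u; apply: comatrix_ext => [x y|x y|phi x]; rewrite ?cractD //.
by rewrite !cractE scalerA.
Qed.
Fact cract1 : left_id 1 cract.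
Proof.
by apply: comatrix_ext => [x y|x y|phi x]; rewrite ?cractD // cractE scale1r.
Qed.
Fact cractDl u : {morph cract^~ u : a b / a + b}.
Proof.
move=> a b; move: u; apply: comatrix_ext => [x y|x y|phi x]; rewrite ?cractD //.
  by rewrite addrACA.
by rewrite !cractE scalerDl cpureDr.
Qed.

HB.instance Definition _ := GRing.Zmodule_isLmodule.Build A^c comatrix
  cractA cract1 cractD cractDl.

Lemma cpure_ract phi x (a : A) : cpure phi x *r a = cpure phi (x *r a).
Proof. exact: cractE. Qed.

Fact cleftDl u : {morph cleft^~ u : a b / a + b}.
Proof.
move=> a b; move: u; apply: comatrix_ext => [x y|x y|phi x]; rewrite ?cleftD //.
  by rewrite addrACA.
rewrite !cleftE -cpureDl; congr cpure; apply: rdualP => y.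
by rewrite evDl !ev_ldual mulrDl.
Qed.
Fact cleftA a b u : cleft a (cleft b u) = cleft (a * b) u.
Proof.
move: u; apply: comatrix_ext => [x y|x y|phi x]; rewrite ?cleftD //.
rewrite !cleftE; congr cpure; apply: rdualP => y.
by rewrite !ev_ldual mulrA.
Qed.
Fact cleft1 u : cleft 1 u = u.
Proof.
move: u; apply: comatrix_ext => [x y|x y|phi x]; rewrite ?cleftD //.
rewrite !cleftE; congr cpure; apply: rdualP => y.
by rewrite !ev_ldual mul1r.
Qed.
Fact cleft_ract a u b : cleft a u *r b = cleft a (u *r b).
Proof.
move: u; apply: comatrix_ext => [x y|x y|phi x]; rewrite ?(cleftD, scalerDr) //.
by rewrite !(cleftE, cpure_ract).
Qed.

(* Scalars of [K] act on [S] by comodule endomorphisms. *)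
Section Central.
Variable k : K.

Definition kact_fun (x : S) : S := x *r eta k.

Fact kact_linear : linear kact_fun.
Proof.
move=> a x y; rewrite /kact_fun scalerDr !scalerA; congr (_ *: _ + _).
exact: (esym (alg_central eta k a)).
Qed.

HB.instance Definition _ :=
  GRing.isLinear.Build A^c S S *:%R kact_fun kact_linear.

Definition kact_lin : {linear S -> S} := kact_fun.

Fact kactP x : coact S (kact_lin x) = tmap kact_lin id (coact S x).
Proof.
rewrite linearZ /=; move: (coact S x); apply: tensA_ext => [u v|u v|y c].
- by rewrite scalerDr.
- exact: tmap_idD.
- by rewrite pureA_ract -lact_central -pureA_mid tmap_idE.
Qed.

Definition kact : endo := ComodHom kactP.

End Central.

Fact cleft_central k u : cleft (eta k) u = u *r eta k.
Proof.
move: u; apply: comatrix_ext => [x y|x y|phi x]; rewrite ?(cleftD, scalerDr) //.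
rewrite cleftE cpure_ract -[RHS](cpure_mid phi (kact k)).
congr cpure; apply: rdualP => y.
by rewrite ev_ldual alg_central -ev_ract.
Qed.

HB.instance Definition _ := isBimodule.Build K A eta comatrix
  cleftD cleftDl cleftA cleft1 cleft_ract cleft_central.

Lemma lact_cpure a phi x : a *l cpure phi x = cpure (ldual a phi) x.
Proof. exact: cleftE. Qed.

Section ComatrixCoring.
Variable d : dual_basis S.
Local Notation e := (db_vec (d := d)).
Local Notation e' := (db_form (d := d)).

Definition comatrix_comult : comatrix -> tensA comatrix comatrix :=
  clift (fun phi x => \sum_i pureA (cpure phi (e i)) (cpure (e' i) x)).

Definition comatrix_counit : comatrix -> (A^c)^o := clift (@ev A S).

Lemma comatrix_comult_balanced :
  cbalanced (fun phi x => \sum_i pureA (cpure phi (e i)) (cpure (e' i) x)).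
Proof.
split=> [phi psi x|phi x y|phi t x].
- by rewrite -big_split; apply: eq_bigr => i _; rewrite cpureDl pureADl.
- by rewrite -big_split; apply: eq_bigr => i _; rewrite cpureDr pureADr.
transitivity (\sum_i \sum_j
   pureA (cpure phi (e j)) (cpure (ldual (ev (e' j) (t (e i))) (e' i)) x)).
  apply: eq_bigr => i _; rewrite cpure_mid (db_eq d (t (e i))).
  rewrite (morph_sum _ _ (cpureDr phi)).
  rewrite (morph_sum _ _ (fun u v => pureADl u v _)).
  by apply: eq_bigr => j _; rewrite -cpure_ract pureA_mid lact_cpure -db_eq.
rewrite exchange_big; apply: eq_bigr => j _ /=.
rewrite -(morph_sum _ _ (pureADr _)); congr pureA.
rewrite -(morph_sum _ _ (fun u v => cpureDl u v x)) -cpure_mid; congr cpure.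
apply: rdualP => y; rewrite [RHS]/(ev _ _) /= {2}(db_eq d y).
rewrite linear_sum [RHS](morph_sum _ _ (evDr (e' j))).
rewrite (morph_sum _ _ (fun u v => evDl u v y)).
by apply: eq_bigr => i _; rewrite linearZ ev_ract.
Qed.

Lemma comatrix_counit_balanced : cbalanced (@ev A S).
Proof. by split=> // phi x y; rewrite evDr. Qed.

Lemma comatrix_comultE phi x : comatrix_comult (cpure phi x) =
  \sum_i pureA (cpure phi (e i)) (cpure (e' i) x).
Proof. exact: cliftE comatrix_comult_balanced. Qed.

Lemma comatrix_counitE phi x : comatrix_counit (cpure phi x) = ev phi x.
Proof. exact: cliftE comatrix_counit_balanced. Qed.

Lemma comatrix_comultD : {morph comatrix_comult : u v / u + v}.
Proof. exact: cliftD comatrix_comult_balanced. Qed.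

Lemma comatrix_counitD : {morph comatrix_counit : u v / u + v}.
Proof. exact: cliftD comatrix_counit_balanced. Qed.

Fact comatrix_comult_linear : linear comatrix_comult.
Proof.
move=> a u v; rewrite comatrix_comultD; congr (_ + _).
move: u; apply: comatrix_ext => [x y|x y|phi x];
  rewrite ?(comatrix_comultD, scalerDr) ?comatrix_comultD //.
rewrite cpure_ract !comatrix_comultE scaler_sumr.
by apply: eq_bigr => i _; rewrite pureA_ract cpure_ract.
Qed.

Fact comatrix_counit_linear : linear comatrix_counit.
Proof.
move=> a u v; rewrite comatrix_counitD; congr (_ + _).
move: u; apply: comatrix_ext => [x y|x y|phi x];
  rewrite ?(comatrix_counitD, scalerDr) ?comatrix_counitD //.
by rewrite cpure_ract !comatrix_counitE ev_ract.
Qed.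

HB.instance Definition _ := GRing.isLinear.Build A^c comatrix
  (tensA comatrix comatrix) *:%R comatrix_comult comatrix_comult_linear.
HB.instance Definition _ := GRing.isLinear.Build A^c comatrix
  (A^c)^o *:%R comatrix_counit comatrix_counit_linear.

Fact comatrix_comult_lact (a : A) u :
  comatrix_comult (a *l u) = a *l comatrix_comult u.
Proof.
move: u; apply: comatrix_ext => [x y|x y|phi x];
  rewrite ?(lactDr, comatrix_comultD) //.
rewrite lact_cpure !comatrix_comultE (morph_sum _ _ (lactDr _)).
by apply: eq_bigr => i _; rewrite lact_pureA lact_cpure.
Qed.

Fact comatrix_counit_lact (a : A) u :
  comatrix_counit (a *l u) = a * (comatrix_counit u : A).
Proof.
move: u; apply: comatrix_ext => [x y|x y|phi x];
  rewrite ?(lactDr, comatrix_counitD) ?mulrDr //.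
by rewrite lact_cpure !comatrix_counitE.
Qed.

Fact comatrix_comultA u :
  tassoc (tmap comatrix_comult id (comatrix_comult u)) =
  tmap id comatrix_comult (comatrix_comult u).
Proof.
pose B : bimodType eta := comatrix; have aD := @tassocD K A eta B B B.
have rD := id_tmapD (M := comatrix) comatrix_comultD comatrix_comult_lact.
have rE := id_tmapE (M := comatrix) _ _ comatrix_comultD comatrix_comult_lact.
move: u; apply: comatrix_ext => [u v|u v|phi x].
- by rewrite comatrix_comultD tmap_idD; apply: aD.
- by rewrite comatrix_comultD rD.
rewrite comatrix_comultE (morph_sum _ _ (@tmap_idD _ _ _ _ _ _ _)).
rewrite (morph_sum _ _ aD) (morph_sum _ _ rD).
transitivity (\sum_i \sum_j
  pureA (cpure phi (e j)) (pureA (cpure (e' j) (e i)) (cpure (e' i) x))).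
  apply: eq_bigr => i _; rewrite tmap_idE /= comatrix_comultE.
  rewrite (morph_sum _ _ (fun u v => pureADl u v _)).
  rewrite (morph_sum _ _ aD).
  by apply: eq_bigr => j _; rewrite tassocE.
rewrite exchange_big; apply: eq_bigr => j _ /=.
by rewrite rE comatrix_comultE (morph_sum _ _ (pureADr _)).
Qed.

Fact comatrix_counitl u :
  tliftA (fun v w : comatrix => (comatrix_counit v : A) *l w)
    (comatrix_comult u) = u.
Proof.
have b : balancedA (fun v w : comatrix => (comatrix_counit v : A) *l w).
  split=> [v v' w|v w w'|v a w]; rewrite ?lactDr //.
    by rewrite comatrix_counitD lactDl.
  by rewrite linearZ lactA.
move: u; apply: comatrix_ext => [u v|u v|phi x] //.
  by rewrite comatrix_comultD (tliftAD b).
rewrite comatrix_comultE (morph_sum _ _ (tliftAD b)).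
under eq_bigr => i _ do rewrite (tliftAE _ _ b) comatrix_counitE lact_cpure.
rewrite -(morph_sum _ _ (fun u v => cpureDl u v x)); congr cpure.
apply: rdualP => y; rewrite (morph_sum _ _ (fun u v => evDl u v y)).
rewrite {2}(db_eq d y) (morph_sum _ _ (evDr phi)).
by apply: eq_bigr => i _; rewrite ev_ract.
Qed.

Fact comatrix_counitr u :
  tliftA (fun v w : comatrix => v *r (comatrix_counit w : A))
    (comatrix_comult u) = u.
Proof.
have b : balancedA (fun v w : comatrix => v *r (comatrix_counit w : A)).
  split=> [v v' w|v w w'|v a w]; rewrite ?scalerDr //.
    by rewrite comatrix_counitD scalerDl.
  by rewrite comatrix_counit_lact scalerA.
move: u; apply: comatrix_ext => [u v|u v|phi x] //.
  by rewrite comatrix_comultD (tliftAD b).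
rewrite comatrix_comultE (morph_sum _ _ (tliftAD b)).
under eq_bigr => i _ do rewrite (tliftAE _ _ b) comatrix_counitE cpure_ract.
by rewrite -(morph_sum _ _ (cpureDr phi)) -db_eq.
Qed.

Definition comatrix_coring : coring eta :=
  @Coring K A eta comatrix comatrix_comult comatrix_counit
    comatrix_comult_lact comatrix_counit_lact comatrix_comultA
    comatrix_counitl comatrix_counitr.

End ComatrixCoring.

Definition can : comatrix -> C :=
  clift (fun phi x => tliftA (fun (y : S) (c : C) => ev phi y *l c) (coact S x)).

Lemma can_at_balanced (phi : rdual S) :
  balancedA (fun (y : S) (c : C) => ev phi y *l c).
Proof.
split=> [y y' c|y c c'|y a c]; first by rewrite evDr lactDl.
  exact: lactDr.
by rewrite ev_ract lactA.
Qed.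

Lemma can_balanced : cbalanced
  (fun phi x => tliftA (fun (y : S) (c : C) => ev phi y *l c) (coact S x)).
Proof.
split=> [phi psi x|phi x y|phi t x].
- move: (coact S x); apply: tensA_ext => [u v|u v|y c].
  + exact: tliftAD (can_at_balanced _) _ _.
  + by rewrite !(tliftAD (can_at_balanced _)) addrACA.
  + by rewrite !(tliftAE _ _ (can_at_balanced _)) evDl lactDl.
- by rewrite linearD (tliftAD (can_at_balanced _)).
rewrite /endo_app comod_funP; move: (coact S x).
apply: tensA_ext => [u v|u v|y c].
- exact: tliftAD (can_at_balanced _) _ _.
- by rewrite tmap_idD (tliftAD (can_at_balanced _)).
- rewrite tmap_idE.
  by rewrite !(tliftAE _ _ (can_at_balanced _)).
Qed.

(* [can (phi (x) x) = phi(x_0) x_1] *)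
Lemma canE phi x :
  can (cpure phi x) =
  tliftA (fun (y : S) (c : C) => ev phi y *l c) (coact S x).
Proof. exact: cliftE can_balanced. Qed.

End Comatrix.

Section CanHom.
Variables (K : comPzRingType) (A : pzRingType) (eta : alg_struct K A).
Variables (C : coring eta) (S : comodule C) (d : dual_basis S).

Definition ev_lact (D : bimodType eta) (phi : rdual S) : tensA S D -> D :=
  tliftA (fun (y : S) (c : D) => ev phi y *l c).

Lemma ev_lact_balanced (D : bimodType eta) (phi : rdual S) :
  balancedA (fun (y : S) (c : D) => ev phi y *l c).
Proof.
split=> [y y' c|y c c'|y a c]; first by rewrite evDr lactDl.
  exact: lactDr.
by rewrite ev_ract lactA.
Qed.

Lemma ev_lactD (D : bimodType eta) phi : {morph @ev_lact D phi : u v / u + v}.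
Proof. exact: tliftAD (ev_lact_balanced _ _). Qed.

Lemma ev_lactE (D : bimodType eta) phi (y : S) (c : D) :
  ev_lact phi (pureA y c) = ev phi y *l c.
Proof. exact: tliftAE (ev_lact_balanced _ _). Qed.

Lemma can_pure phi x : can (cpure phi x) = ev_lact phi (coact S x).
Proof. exact: canE. Qed.

Lemma canD : {morph @can K A eta C S : u v / u + v}.
Proof. exact: cliftD (can_balanced S). Qed.

Lemma can_lact (a : A) (u : comatrix S) : can (a *l u) = a *l can u.
Proof.
move: u; apply: comatrix_ext => [u v|u v|phi x]; rewrite ?(lactDr, canD) //.
rewrite lact_cpure !can_pure; move: (coact S x).
apply: tensA_ext => [u v|u v|y c]; rewrite ?(ev_lactD, lactDr) //.
by rewrite !ev_lactE ev_ldual lactA.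
Qed.

Lemma can_ract (a : A) (u : comatrix S) : can (u *r a) = can u *r a.
Proof.
move: u; apply: comatrix_ext => [u v|u v|phi x]; rewrite ?(scalerDr, canD) //.
rewrite cpure_ract !can_pure linearZ /=; move: (coact S x).
apply: tensA_ext => [u v|u v|y c].
- by rewrite scalerDr ev_lactD.
- by rewrite ev_lactD scalerDr.
by rewrite pureA_ract !ev_lactE lact_ract.
Qed.

Lemma can_counit (u : comatrix S) : counit C (can u) = comatrix_counit u.
Proof.
move: u; apply: comatrix_ext => [u v|u v|phi x].
- by rewrite canD linearD.
- exact: comatrix_counitD.
have b : balancedA (fun (y : S) (c : C) => y *r (counit C c : A)).
  split=> [y y' c|y c c'|y a c]; first exact: scalerDr.
    by rewrite linearD scalerDl.
  by rewrite counit_lact scalerA.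
rewrite comatrix_counitE can_pure -[in RHS](coact1 x); move: (coact S x).
apply: tensA_ext => [u v|u v|y c].
- by rewrite ev_lactD linearD.
- by rewrite (tliftAD b) evDr.
by rewrite (tliftAE _ _ b) ev_lactE ev_ract counit_lact.
Qed.

Lemma can_comult (u : comatrix S) :
  comult C (can u) = tmap (@can K A eta C S) (@can K A eta C S) (comatrix_comult d u).
Proof.
pose canL : {linear comatrix S -> C} := HB.pack (@can K A eta C S)
  (GRing.isNmodMorphism.Build _ _ (@can K A eta C S) (morphD0 canD, canD))
  (GRing.isScalable.Build A^c _ _ *:%R (@can K A eta C S) can_ract).
have tD := tmapD canL canD can_lact.
have tE := tmapE canL _ _ canD can_lact.
move: u; apply: comatrix_ext => [u v|u v|phi x].
- by rewrite canD linearD.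
- by rewrite comatrix_comultD tD.
rewrite comatrix_comultE (morph_sum _ _ tD) can_pure.
transitivity (ev_lact phi (tmap id (comult C) (coact S x))).
  have rD := id_tmapD (linearD (comult C)) (@comult_lact _ _ _ C).
  have rE := id_tmapE _ _ (linearD (comult C)) (@comult_lact _ _ _ C).
  move: (coact S x); apply: tensA_ext => [u v|u v|y c].
  - by rewrite ev_lactD linearD.
  - by rewrite rD ev_lactD.
  by rewrite rE !ev_lactE comult_lact.
rewrite -coactA; under [RHS]eq_bigr => i _ do rewrite tE /= !can_pure.
move: (coact S x); apply: tensA_ext => [u v|u v|y c].
- by rewrite tmap_idD tassocD ev_lactD.
- by rewrite -big_split; apply: eq_bigr => i _; rewrite ev_lactD pureADr.
under eq_bigr => i _ do rewrite ev_lactE -pureA_mid -can_pure -can_ract cpure_ract.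
rewrite -(morph_sum _ _ (fun u v => pureADl u v c)) -(morph_sum _ _ canD).
rewrite -(morph_sum _ _ (cpureDr phi)) -db_eq can_pure tmap_idE.
move: (coact S y); apply: tensA_ext => [u v|u v|z b].
- by rewrite pureADl tassocD ev_lactD.
- by rewrite ev_lactD pureADl.
by rewrite tassocE !ev_lactE lact_pureA.
Qed.

Lemma can_coring_hom : @coring_hom K A eta (comatrix_coring d) C (@can K A eta C S).
Proof.
split; [exact: canD|exact: can_lact|exact: can_ract|exact: can_comult|].
exact: can_counit.
Qed.

End CanHom.

Section Galois.
Variables (K : comPzRingType) (A : pzRingType) (eta : alg_struct K A).
Variables (C : coring eta) (S : comodule C).
Hypotheses (fgS : fin_gen S) (projS : projective S).

(* The choice of the dual basis is immaterial: the comultiplication of the    *)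
(* comatrix coring does not depend on it.                                     *)
Definition comod_dual_basis : dual_basis S :=
  projT1 (cid (fgp_dual_basis fgS projS)).

Definition galois : Prop :=
  @coring_iso K A eta (comatrix_coring comod_dual_basis) C (@can K A eta C S).

End Galois.

Section DirectSum.
Variables (R : pzRingType) (I : choiceType) (M : lmodType R).

Definition dsum : Type := {fsfun I -> M with 0}.
HB.instance Definition _ := Choice.on dsum.
Definition dcoef (s : dsum) : I -> M := fun i => (s : {fsfun I -> M with 0}) i.

Definition dzero : dsum := [fsfun].
Definition dopp (s : dsum) : dsum := [fsfun i in finsupp s => - s i].
Definition dadd (s t : dsum) : dsum :=
  [fsfun i in (finsupp s `|` finsupp t)%fset => s i + t i].
Definition dscale (a : R) (s : dsum) : dsum := [fsfun i in finsupp s => a *: s i].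

Lemma dsumP (s t : dsum) : dcoef s =1 dcoef t -> s = t.
Proof. by move/fsfunP. Qed.

Lemma dcoef0 i : dcoef dzero i = 0.
Proof. by rewrite /dcoef fsfunE. Qed.
Lemma dcoefN s i : dcoef (dopp s) i = - dcoef s i.
Proof. by rewrite /dcoef fsfunE; case: finsuppP => //; rewrite oppr0. Qed.
Lemma dcoefD s t i : dcoef (dadd s t) i = dcoef s i + dcoef t i.
Proof.
rewrite /dcoef fsfunE in_fsetU.
by case: (finsuppP s); case: (finsuppP t) => //=; rewrite addr0.
Qed.
Lemma dcoefZ a s i : dcoef (dscale a s) i = a *: dcoef s i.
Proof. by rewrite /dcoef fsfunE; case: finsuppP => //; rewrite scaler0. Qed.

Fact daddA : associative dadd.
Proof. by move=> s t u; apply: dsumP => i; rewrite !dcoefD addrA. Qed.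
Fact daddC : commutative dadd.
Proof. by move=> s t; apply: dsumP => i; rewrite !dcoefD addrC. Qed.
Fact dadd0 : left_id dzero dadd.
Proof. by move=> s; apply: dsumP => i; rewrite !dcoefD dcoef0 add0r. Qed.
Fact daddN : left_inverse dzero dopp dadd.
Proof. by move=> s; apply: dsumP => i; rewrite !dcoefD dcoefN dcoef0 addNr. Qed.
HB.instance Definition _ := GRing.isZmodule.Build dsum daddA daddC dadd0 daddN.

Fact dscaleA a b s : dscale a (dscale b s) = dscale (a * b) s.
Proof. by apply: dsumP => i; rewrite !dcoefZ scalerA. Qed.
Fact dscale1 : left_id 1 dscale.
Proof. by move=> s; apply: dsumP => i; rewrite dcoefZ scale1r. Qed.
Fact dscaleDr : right_distributive dscale +%R.
Proof. by move=> a s t; apply: dsumP => i; rewrite !(dcoefD, dcoefZ) scalerDr. Qed.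
Fact dscaleDl s : {morph dscale^~ s : a b / a + b}.
Proof. by move=> a b; apply: dsumP => i; rewrite !(dcoefD, dcoefZ) scalerDl. Qed.
HB.instance Definition _ := GRing.Zmodule_isLmodule.Build R dsum
  dscaleA dscale1 dscaleDr dscaleDl.

Lemma dcoef_add (s t : dsum) i : dcoef (s + t) i = dcoef s i + dcoef t i.
Proof. exact: dcoefD. Qed.
Lemma dcoef_scale a (s : dsum) i : dcoef (a *: s) i = a *: dcoef s i.
Proof. exact: dcoefZ. Qed.

Definition dinj (i : I) (x : M) : dsum := [fsfun j in [fset i]%fset => x].

Lemma dcoef_inj i x j : dcoef (dinj i x) j = if j == i then x else 0.
Proof. by rewrite /dcoef fsfunE in_fset1. Qed.

Fact dinj_linear i : linear (dinj i).
Proof.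
move=> a x y; apply: dsumP => j; rewrite dcoef_add dcoef_scale !dcoef_inj.
by case: eqP; rewrite // scaler0 addr0.
Qed.
HB.instance Definition _ i := GRing.isLinear.Build R M dsum *:%R (dinj i)
  (dinj_linear i).

(* The additive map out of the direct sum with components [F i]. *)
Definition dlift (G : zmodType) (F : I -> M -> G) (s : dsum) : G :=
  \sum_(i <- finsupp s) F i (dcoef s i).

Section Lift.
Variables (G : zmodType) (F : I -> M -> G).
Hypothesis FD : forall i, {morph F i : x y / x + y}.

Lemma dlift_incl (T : {fset I}) (s : dsum) : (finsupp s `<=` T)%fset ->
  dlift F s = \sum_(i <- T) F i (dcoef s i).
Proof.
move=> sT; apply: big_fset_incl => // i _ /fsfun_dflt.
by rewrite /dcoef => ->; rewrite morphD0.
Qed.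

Lemma dliftD : {morph dlift F : s t / s + t}.
Proof.
move=> s t; pose T := (finsupp s `|` finsupp t `|` finsupp (dadd s t))%fset.
have sT : (finsupp s `<=` T)%fset by rewrite /T -fsetUA fsubsetUl.
have tT : (finsupp t `<=` T)%fset by rewrite /T fsetUAC fsubsetUr.
have stT : (finsupp (dadd s t) `<=` T)%fset by rewrite /T fsubsetUr.
rewrite (dlift_incl sT) (dlift_incl tT) (dlift_incl stT).
by rewrite -big_split; apply: eq_bigr => i _; rewrite dcoef_add FD.
Qed.

Lemma dlift_inj i x : dlift F (dinj i x) = F i x.
Proof.
rewrite (@dlift_incl [fset i]%fset); last exact: finsupp_sub.
by rewrite big_seq_fset1 dcoef_inj eqxx.
Qed.

End Lift.

Lemma dsum_ext (G : zmodType) (f g : dsum -> G) :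
  {morph f : x y / x + y} -> {morph g : x y / x + y} ->
  (forall i x, f (dinj i x) = g (dinj i x)) -> f =1 g.
Proof.
move=> fD gD fg s; have -> : s = \sum_(i <- finsupp s) dinj i (dcoef s i).
  apply: dsumP => j; rewrite (morph_sum _ _ (fun s t => dcoef_add s t j)).
  under eq_bigr => i _ do rewrite dcoef_inj.
  have [js|jN] := boolP (j \in finsupp s).
    rewrite (big_fsetD1 j) //= eqxx big_seq big1 ?addr0 // => i.
    by rewrite !inE eq_sym => /andP[/negPf ->].
  rewrite /dcoef fsfun_dflt // big_seq big1 // => i si.
  by case: eqP => // ji; rewrite ji si in jN.
rewrite (morph_sum _ _ fD) (morph_sum _ _ gD); apply: eq_bigr => i _.
exact: fg.
Qed.

End DirectSum.

Section DirectSumComodule.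
Variables (K : comPzRingType) (A : pzRingType) (eta : alg_struct K A).
Variables (C : coring eta) (I : choiceType) (S : comodule C).

Definition dsum_coact : dsum I S -> tensA (dsum I S) C :=
  dlift (fun i x => tmap (dinj i) id (coact S x)).

Lemma dsum_coact_inj i x :
  dsum_coact (dinj i x) = tmap (dinj i) id (coact S x).
Proof. by apply: dlift_inj => j y z; rewrite linearD tmap_idD. Qed.

Lemma dsum_coactD : {morph dsum_coact : s t / s + t}.
Proof. by apply: dliftD => i x y; rewrite linearD tmap_idD. Qed.

Fact dsum_coact_linear : linear dsum_coact.
Proof.
move=> a s t; rewrite dsum_coactD; congr (_ + _).
move: s; apply: dsum_ext => [x y|x y|i x]; rewrite ?(scalerDr, dsum_coactD) //.
rewrite -linearZ !dsum_coact_inj linearZ /=; move: (coact S x).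
apply: tensA_ext => [u v|u v|y c]; rewrite ?(scalerDr, tmap_idD) //.
by rewrite pureA_ract !tmap_idE pureA_ract.
Qed.

HB.instance Definition _ := GRing.isLinear.Build A^c (dsum I S)
  (tensA (dsum I S) C) *:%R dsum_coact dsum_coact_linear.

Fact dsum_coactA s :
  tassoc (tmap dsum_coact id (dsum_coact s)) =
  tmap id (comult C) (dsum_coact s).
Proof.
have rD := id_tmapD (linearD (comult C)) (@comult_lact _ _ _ C).
have rE := id_tmapE _ _ (linearD (comult C)) (@comult_lact _ _ _ C).
move: s; apply: dsum_ext => [s t|s t|i x].
- by rewrite dsum_coactD tmap_idD tassocD.
- by rewrite dsum_coactD rD.
rewrite dsum_coact_inj.
transitivity (tmap (dinj i) id (tassoc (tmap (coact S) id (coact S x)))).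
  move: (coact S x); apply: tensA_ext => [u v|u v|y c].
  - by rewrite !tmap_idD tassocD.
  - by rewrite !(tmap_idD, tassocD).
  rewrite !tmap_idE /= dsum_coact_inj; move: (coact S y).
  apply: tensA_ext => [u v|u v|z b]; rewrite ?(tmap_idD, pureADl, tassocD) //.
  by rewrite !(tmap_idE, tassocE).
rewrite coactA; move: (coact S x).
apply: tensA_ext => [u v|u v|y c]; rewrite ?(tmap_idD, rD) //.
by rewrite !(rE, tmap_idE).
Qed.

Fact dsum_coact1 s :
  tliftA (fun (x : dsum I S) (c : C) => x *r (counit C c : A)) (dsum_coact s) = s.
Proof.
have b (X : lmodType A^c) :
    balancedA (fun (x : X) (c : C) => x *r (counit C c : A)).
  split=> [x y c|x c c'|x a c]; first exact: scalerDr.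
    by rewrite linearD scalerDl.
  by rewrite counit_lact scalerA.
move: s; apply: dsum_ext => [s t|s t|i x] //.
  by rewrite dsum_coactD (tliftAD (b _)).
rewrite dsum_coact_inj -[in RHS](coact1 x); move: (coact S x).
apply: tensA_ext => [u v|u v|y c].
- by rewrite tmap_idD (tliftAD (b _)).
- by rewrite (tliftAD (b _)) linearD.
by rewrite tmap_idE !(tliftAE _ _ (b _)) linearZ.
Qed.

Definition dsum_comod : comodule C := Comodule dsum_coactA dsum_coact1.

End DirectSumComodule.

Section ComoduleCategory.
Variables (K : comPzRingType) (A : pzRingType) (eta : alg_struct K A).
Variable C : coring eta.
Implicit Types W X Y Z Q : comodule C.

Lemma comod_homP X Y (f g : comod_hom X Y) : f =1 g -> f = g.
Proof.
case: f g => [f fP] [g gP] /= /(@eq_linear A^c X Y) efg; rewrite efg in fP *.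
by rewrite (Prop_irrelevance fP gP).
Qed.

Fact comod_zeroP X Y x :
  coact Y (lin_zero X Y x) = tmap (lin_zero X Y) id (coact X x).
Proof.
rewrite [lin_zero X Y x]/(0 : Y) linear0; move: (coact X x).
apply: tensA_ext => [u v|u v|y c]; first by rewrite addr0.
  exact: tmap_idD.
rewrite tmap_idE [lin_zero X Y y]/(0 : Y).
exact/esym/(morphD0 (fun u v => pureADl u v c)).
Qed.

Definition comod_zero X Y : comod_hom X Y := ComodHom (@comod_zeroP X Y).

Definition is_kernel W Y Z (k : comod_hom W Y) (g : comod_hom Y Z) : Prop :=
  comod_comp g k = comod_zero W Z /\
  forall X (h : comod_hom X Y), comod_comp g h = comod_zero X Z ->
    exists! u : comod_hom X W, comod_comp k u = h.

Definition is_cokernel X Y Q (q : comod_hom Y Q) (f : comod_hom X Y) : Prop :=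
  comod_comp q f = comod_zero X Q /\
  forall Z (h : comod_hom Y Z), comod_comp h f = comod_zero X Z ->
    exists! u : comod_hom Q Z, comod_comp u q = h.

Definition is_epi Y Z (g : comod_hom Y Z) : Prop :=
  forall W (h h' : comod_hom Z W), comod_comp h g = comod_comp h' g -> h = h'.

(* The image of [f], which is the kernel of its cokernel, is the kernel of [g]. *)
Definition exact_at X Y Z (f : comod_hom X Y) (g : comod_hom Y Z) : Prop :=
  exists W Q (k : comod_hom W Y) (q : comod_hom Y Q),
    [/\ is_cokernel q f, is_kernel k q & is_kernel k g].

(* [X -> Y -> Z -> 0] is exact in the category of right comodules. *)
Definition right_exact_seq X Y Z (f : comod_hom X Y) (g : comod_hom Y Z) : Prop :=
  exact_at f g /\ is_epi g.

(* [Hom_C(S, X) -> Hom_C(S, Y) -> Hom_C(S, Z) -> 0] is exact. *)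
Definition hom_right_exact (S X Y Z : comodule C)
    (f : comod_hom X Y) (g : comod_hom Y Z) : Prop :=
  (forall h : comod_hom S Y, comod_comp g h = comod_zero S Z <->
     exists h' : comod_hom S X, comod_comp f h' = h) /\
  (forall h : comod_hom S Z, exists h' : comod_hom S Y, comod_comp g h' = h).

End ComoduleCategory.

(* Main.v *)
(* Write [Hom_C(S, C) = S^*] through [h |-> eps \o h].  For a comodule map    *)
(* [g : S^(I) -> C] with components [phi_i] in [S^*], the map [theta] sending *)
(* [x] in the [i]-th summand to [phi_i (x) x] satisfies [can \o theta = g],   *)
(* and, [S] being finitely generated, [theta (h x) = (eps \o g \o h) (x) x]   *)
(* for all comodule maps [h : S -> S^(I)].  If [Hom_C(S, g)] is onto, so is   *)
(* [theta]; if [ker g] is the image of a comodule map [f : S^(J) -> S^(I)],   *)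
(* [theta] kills it, so that [can] is injective.  Conversely take [I = S^*]   *)
(* and let [J] consist of all [h : S -> S^(I)] with [g \o h = 0]: if [can] is *)
(* injective, these maps account for all the relations defining               *)
(* [S^* (x)_T S], hence for [ker g].  Flatness makes kernels of surjective    *)
(* comodule maps subcomodules, so exactness in the category of comodules is   *)
(* exactness of the underlying modules.                                       *)
From HB Require Import structures.
From mathcomp Require Import all_boot all_algebra.
From mathcomp Require Import generic_quotient finmap boolp.
Require Import Defs.

Set Implicit Arguments.
Unset Strict Implicit.
Unset Printing Implicit Defensive.

Import GRing.Theory.
Local Open Scope ring_scope.
Local Open Scope quotient_scope.

(** Conceptually, [can] is the evaluation map [Hom_C(S, X) (x)_T S -> X] for [X = C], once
    [Hom_C(S, C)] is identified with [S^*] ([comod_hom_canE], [counit_can_form]). For [X = S^(I)]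
    the evaluation is bijective: finite generation of [S] gives [Hom_C(S, S^(I)) = T^(I)]
    ([dsum_common_support], [cpure_dsum_hom]).

    If the sequence of Hom groups is exact, applying the right exact functor [- (x)_T S] to it
    presents [S^* (x)_T S] as the cokernel of [S^(J) -> S^(I)]. The given exact sequence presents
    [C] as the same cokernel, so [can] is bijective ([hom_exact_bij_can]). Conversely, a
    presentation of [S^*] as a right [T]-module by copies of [T], tensored with [S], presents
    [S^* (x)_T S], hence [C] when [can] is bijective ([bij_can_hom_exact]). The map [theta] carries
    both arguments at the level of elements.

    Exactness in the category of comodules is defined by universal properties. Flatness turns it
    into exactness of the underlying modules ([exact_atP]), and epimorphisms are the surjections
    ([is_epi_surj], [surj_is_epi]). *)

(** * Cokernels and kernels of linear maps *)

Section CokernelModule.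
Variables (R : pzRingType) (U V : lmodType R) (f : {linear U -> V}).

Definition im_eqv (x y : V) : bool := `[< exists u, f u = x - y >].

Lemma im_eqv_is_equiv : equiv_class_of im_eqv.
Proof.
split=> [x|x y|y x z].
- by apply/asboolP; exists 0; rewrite linear0 subrr.
- by apply/asboolP/asboolP => -[u fu]; exists (- u); rewrite linearN fu opprB.
move=> /asboolP[u fu] /asboolP[v fv]; apply/asboolP; exists (u + v).
by rewrite linearD fu fv addrA subrK.
Qed.

Canonical im_eqv_equiv := EquivRelPack im_eqv_is_equiv.

Definition coker_mod : Type := {eq_quot im_eqv_equiv}.
HB.instance Definition _ := Choice.on coker_mod.
HB.instance Definition _ := EqQuotient.on coker_mod.

Definition coker_pi (x : V) : coker_mod := \pi_coker_mod x.

Lemma coker_pi_eqP x y : coker_pi x = coker_pi y <-> exists u, f u = x - y.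
Proof. by split=> [/eqmodP/asboolP|h] //; apply/eqmodP/asboolP. Qed.

Lemma repr_coker_pi x : exists u, f u = repr (coker_pi x) - x.
Proof. by apply/coker_pi_eqP; rewrite /coker_pi reprK. Qed.

Lemma coker_pi_surj q : exists x, coker_pi x = q.
Proof. by exists (repr q); rewrite /coker_pi reprK. Qed.

Definition coker_add (p q : coker_mod) := coker_pi (repr p + repr q).
Definition coker_opp (p : coker_mod) := coker_pi (- repr p).
Definition coker_scale (a : R) (p : coker_mod) := coker_pi (a *: repr p).

Lemma coker_addE x y : coker_add (coker_pi x) (coker_pi y) = coker_pi (x + y).
Proof.
have [[u fu] [v fv]] := (repr_coker_pi x, repr_coker_pi y).
by apply/coker_pi_eqP; exists (u + v); rewrite linearD fu fv opprD addrACA.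
Qed.

Lemma coker_oppE x : coker_opp (coker_pi x) = coker_pi (- x).
Proof.
have [u fu] := repr_coker_pi x.
by apply/coker_pi_eqP; exists (- u); rewrite linearN fu opprB opprK addrC.
Qed.

Lemma coker_scaleE a x : coker_scale a (coker_pi x) = coker_pi (a *: x).
Proof.
have [u fu] := repr_coker_pi x.
by apply/coker_pi_eqP; exists (a *: u); rewrite linearZ /= fu scalerBr.
Qed.

Let coker_ind (P : coker_mod -> Prop) :
  (forall x, P (coker_pi x)) -> forall q, P q.
Proof. by move=> Ppi q; have [x <-] := coker_pi_surj q. Qed.

Fact coker_addA : associative coker_add.
Proof. by do 3![elim/coker_ind=> ?]; rewrite !coker_addE addrA. Qed.
Fact coker_addC : commutative coker_add.
Proof. by do 2![elim/coker_ind=> ?]; rewrite !coker_addE addrC. Qed.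
Fact coker_add0 : left_id (coker_pi 0) coker_add.
Proof. by elim/coker_ind=> ?; rewrite coker_addE add0r. Qed.
Fact coker_addN : left_inverse (coker_pi 0) coker_opp coker_add.
Proof. by elim/coker_ind=> ?; rewrite coker_oppE coker_addE addNr. Qed.
HB.instance Definition _ := GRing.isZmodule.Build coker_mod
  coker_addA coker_addC coker_add0 coker_addN.

Lemma coker_piD x y : coker_pi (x + y) = coker_pi x + coker_pi y.
Proof. exact/esym/coker_addE. Qed.

Fact coker_scaleA a b q : coker_scale a (coker_scale b q) = coker_scale (a * b) q.
Proof. by elim/coker_ind: q => x; rewrite !coker_scaleE scalerA. Qed.
Fact coker_scale1 : left_id 1 coker_scale.
Proof. by elim/coker_ind=> x; rewrite coker_scaleE scale1r. Qed.
Fact coker_scaleDr : right_distributive coker_scale +%R.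
Proof.
move=> a; do 2![elim/coker_ind=> ?].
by rewrite -coker_piD !coker_scaleE scalerDr coker_piD.
Qed.
Fact coker_scaleDl q : {morph coker_scale^~ q : a b / a + b}.
Proof.
move=> a b; elim/coker_ind: q => x.
by rewrite !coker_scaleE scalerDl coker_piD.
Qed.
HB.instance Definition _ := GRing.Zmodule_isLmodule.Build R coker_mod
  coker_scaleA coker_scale1 coker_scaleDr coker_scaleDl.

Fact coker_pi_linear : linear coker_pi.
Proof. by move=> a x y; rewrite coker_piD -coker_scaleE. Qed.
HB.instance Definition _ := GRing.isLinear.Build R V coker_mod *:%R coker_pi
  coker_pi_linear.

Lemma coker_pi_eq0 x : coker_pi x = 0 <-> exists u, f u = x.
Proof. by rewrite -[x in exists u, _ = x]subr0 -coker_pi_eqP. Qed.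

End CokernelModule.

Section KernelModule.
Variables (R : pzRingType) (U V : lmodType R) (f : {linear U -> V}).

Definition in_ker : {pred U} := [pred x | f x == 0].

Fact in_ker_submod : submod_closed in_ker.
Proof.
split=> [|a x y]; rewrite !inE ?linear0 // linearP => /eqP-> /eqP->.
by rewrite scaler0 addr0.
Qed.
HB.instance Definition _ := GRing.isSubmodClosed.Build R U in_ker in_ker_submod.

Record ker_mod := KerMod { ker_val : U; ker_valP : ker_val \in in_ker }.
HB.instance Definition _ := [isSub for ker_val].
HB.instance Definition _ := [Choice of ker_mod by <:].
HB.instance Definition _ := [SubChoice_isSubLmodule of ker_mod by <:].

Definition ker_incl : {linear ker_mod -> U} := val.

Lemma ker_incl_inj : injective ker_incl.
Proof. exact: val_inj. Qed.

Lemma ker_inclP x : f x = 0 <-> exists w, ker_incl w = x.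
Proof.
split=> [/eqP fx|[w <-]]; last exact/eqP/(valP w).
by exists (KerMod fx).
Qed.

End KernelModule.

(** * Right exactness, associativity and flatness of tensor products *)

Section TensorExactness.
Variables (K : comPzRingType) (A : pzRingType) (eta : alg_struct K A).

Section MapLinear.
Variables (M N : lmodType A^c) (C : bimodType eta) (f : {linear M -> N}).

(** A name on which the linear structure of [tmap f id] is declared, so that one can take its
    cokernel and tensor it again. *)
Definition tmapl : tensA M C -> tensA N C := tmap f id.

Fact tmapl_linear : linear tmapl.
Proof.
move=> a u v; rewrite /tmapl tmap_idD; congr (_ + _).
move: u; apply: tensA_ext => [x y|x y|m c]; rewrite ?(scalerDr, tmap_idD) //.
by rewrite pureA_ract !tmap_idE pureA_ract.
Qed.
HB.instance Definition _ := GRing.isLinear.Build A^c (tensA M C) (tensA N C)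
  *:%R tmapl tmapl_linear.

End MapLinear.

Arguments tmapl {M N} C f x.

Lemma tmap_id_comp_lin (M N P : lmodType A^c) (C : bimodType eta)
    (f : {linear M -> N}) (g : {linear N -> P}) (u : tensA M C) :
  tmap g id (tmap f id u) = tmap (g \o f) id u :> tensA P C.
Proof.
move: u; apply: tensA_ext => [x y|x y|x c]; rewrite ?tmap_idD //.
by rewrite !tmap_idE.
Qed.

Lemma tmap_id_eq0 (M N : lmodType A^c) (C : bimodType eta) (f : {linear M -> N})
    (u : tensA M C) :
  f =1 (fun=> 0) -> tmap f id u = 0 :> tensA N C.
Proof.
move=> f0; move: u; apply: tensA_ext => [u v|u v|m c].
- exact: tmap_idD.
- by rewrite addr0.
by rewrite tmap_idE f0; apply: (morphD0 (fun u v => pureADl u v c)).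
Qed.

Lemma tmap_id_exact (M N P : lmodType A^c) (C : bimodType eta)
    (k : {linear M -> N}) (g : {linear N -> P}) :
  (forall p, exists n, g n = p) -> (forall n, g n = 0 -> exists m, k m = n) ->
  forall u : tensA N C, tmap g id u = 0 :> tensA P C ->
    exists v : tensA M C, tmap k id v = u.
Proof.
move=> gsurj kerg u gu.
have [s sK] := choice gsurj.
(* [F] induces an inverse of the map that [g] induces from the cokernel of    *)
(* [k (x) C] to [P (x) C], so an element killed by [g (x) C] is 0 in it.      *)
pose F p (c : C) : coker_mod (tmapl C k) := coker_pi _ (pureA (s p) c).
(* The section [s] need not be additive. This makes [F] balanced all the same: two preimages of one
   element differ by some [k m], and [k m (x) c] dies in the cokernel. *)
have FE n n' c : g n = g n' ->
    coker_pi (tmapl C k) (pureA n c) = coker_pi _ (pureA n' c).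
  move=> gnn'; have [|m km] := kerg (n - n'); first by rewrite linearB gnn' subrr.
  apply/coker_pi_eqP; exists (pureA m c); rewrite /= /tmapl tmap_idE km.
  by apply: (addIr (pureA n' c)); rewrite -pureADl !subrK.
have bF : balancedA F.
  split=> [p p' c|p c c'|p a c].
  - by rewrite /F -linearD -pureADl; apply: FE; rewrite linearD !sK.
  - by rewrite /F -linearD pureADr.
  by rewrite /F -pureA_mid; apply: FE; rewrite linearZ /= !sK.
have FgE : tliftA F (tmap g id u) = coker_pi (tmapl C k) u.
  move: u {gu}; apply: tensA_ext => [u v|u v|n c].
  - by rewrite tmap_idD (tliftAD bF).
  - by rewrite linearD.
  by rewrite tmap_idE (tliftAE _ _ bF); apply: FE; rewrite sK.
apply/(coker_pi_eq0 (tmapl C k)); rewrite -FgE gu.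
exact: (morphD0 (tliftAD bF)).
Qed.

Section AssocInverse.
Variables (M : lmodType A^c) (C D : bimodType eta).

Definition tassoc_inv_at (m : M) : tensA C D -> tensA (tensA M C) D :=
  tliftA (fun c d => pureA (pureA m c) d).

Lemma tassoc_inv_at_balanced (m : M) :
  balancedA (fun (c : C) (d : D) => pureA (pureA m c) d).
Proof.
split=> [c c' d|c d d'|c a d]; first by rewrite pureADr pureADl.
  exact: pureADr.
by rewrite -pureA_ract pureA_mid.
Qed.

Lemma tassoc_inv_atE m c d : tassoc_inv_at m (pureA c d) = pureA (pureA m c) d.
Proof. exact: tliftAE (tassoc_inv_at_balanced m). Qed.

Definition tassoc_inv : tensA M (tensA C D) -> tensA (tensA M C) D :=
  tliftA tassoc_inv_at.

Lemma tassoc_inv_balanced : balancedA tassoc_inv_at.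
Proof.
have tD m : {morph tassoc_inv_at m : x y / x + y}.
  exact: tliftAD (tassoc_inv_at_balanced m).
split=> [m m' x|m x x'|m a x]; last first.
- move: x; apply: tensA_ext => [u v|u v|c d]; first exact: tD.
    by rewrite lactDr; apply: tD.
  by rewrite lact_pureA !tassoc_inv_atE pureA_mid.
- exact: tD.
move: x; apply: tensA_ext => [u v|u v|c d]; first exact: tD.
  by rewrite !(tD m) !(tD m') addrACA.
by rewrite !tassoc_inv_atE !pureADl.
Qed.

Lemma tassoc_invD : {morph tassoc_inv : x y / x + y}.
Proof. exact: tliftAD tassoc_inv_balanced. Qed.

Lemma tassoc_invE m c d :
  tassoc_inv (pureA m (pureA c d)) = pureA (pureA m c) d.
Proof.
by rewrite /tassoc_inv tliftAE ?tassoc_inv_atE //; apply: tassoc_inv_balanced.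
Qed.

Lemma tassoc_invK : cancel tassoc_inv (@tassoc K A eta M C D).
Proof.
apply: tensA_ext => [u v|u v|m x]; rewrite ?(tassoc_invD, tassocD) //.
move: x; apply: tensA_ext => [u v|u v|c d].
- by rewrite pureADr tassoc_invD tassocD.
- by rewrite pureADr.
by rewrite tassoc_invE tassocE.
Qed.

End AssocInverse.

(** Up to associativity, [f (x) (C (x) D)] is [(f (x) C) (x) D], and each of the two tensorings
    preserves injectivity. The case [D = C] serves to check coassociativity on subcomodules. *)
Lemma flat_left_tensA (C D : bimodType eta) :
  flat_left C -> flat_left D -> flat_left (tensA C D).
Proof.
move=> flatC flatD M N f injf.
have nat (u : tensA M (tensA C D)) :
    tassoc_inv (tmap f id u : tensA N (tensA C D)) =
    tmap (tmapl C f) id (tassoc_inv u).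
  move: u; apply: tensA_ext => [u v|u v|m x].
  - by rewrite tmap_idD tassoc_invD.
  - by rewrite tassoc_invD tmap_idD.
  rewrite tmap_idE; move: x; apply: tensA_ext => [u v|u v|c d].
  - by rewrite pureADr tassoc_invD.
  - by rewrite pureADr tassoc_invD tmap_idD.
  by rewrite !tassoc_invE tmap_idE /= /tmapl tmap_idE.
move=> u v fuv; apply: (can_inj (@tassoc_invK M C D)).
by apply: (flatD _ _ (tmapl C f) (flatC _ _ f injf)); rewrite -!nat fuv.
Qed.

End TensorExactness.

Arguments tmapl {K A eta M N} C f x.

(** * Subcomodules and quotient comodules *)

Section CoringAux.
Variables (K : comPzRingType) (A : pzRingType) (eta : alg_struct K A).
Variables (C : coring eta) (M : lmodType A^c).

Lemma id_comultD :
  {morph (tmap id (comult C) : tensA M C -> tensA M (tensA C C)) : u v / u + v}.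
Proof. exact: id_tmapD (linearD _) (@comult_lact _ _ _ C). Qed.

Lemma id_comultE (m : M) (c : C) :
  tmap id (comult C) (pureA m c) = pureA m (comult C c).
Proof. exact: id_tmapE (linearD _) (@comult_lact _ _ _ C). Qed.

Lemma ract_counit_balanced :
  balancedA (fun (x : M) (c : C) => x *r (counit C c : A)).
Proof.
split=> [x y c|x c c'|x a c]; first exact: scalerDr.
  by rewrite linearD scalerDl.
by rewrite counit_lact scalerA.
Qed.

End CoringAux.

Section Subcomodule.
Variables (K : comPzRingType) (A : pzRingType) (eta : alg_struct K A).
Variables (C : coring eta) (Y : comodule C).
Variables (W : lmodType A^c) (k : {linear W -> Y}).
Hypotheses (flatC : flat_left C) (k_inj : injective k).
Hypothesis k_stable : forall w, exists u : tensA W C, tmap k id u = coact Y (k w).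

Let k1_inj : injective (tmap k id : tensA W C -> tensA Y C).
Proof. exact: flatC. Qed.

(** The lift chosen here is unique, because flatness makes [k (x) C] injective; linearity follows
    from this uniqueness. *)
Definition sub_coact (w : W) : tensA W C := projT1 (cid (k_stable w)).

Lemma sub_coactE w : tmap k id (sub_coact w) = coact Y (k w).
Proof. exact: projT2 (cid (k_stable w)). Qed.

Fact sub_coact_linear : linear sub_coact.
Proof.
move=> a x y; apply: k1_inj; rewrite sub_coactE [RHS](linearP (tmapl C k)).
by rewrite /= /tmapl !sub_coactE !linearP.
Qed.
HB.instance Definition _ := GRing.isLinear.Build A^c W (tensA W C) *:%R
  sub_coact sub_coact_linear.

(** Both sides may be compared after the injective map [k (x) (C (x) C)], where the identity becomes
    coassociativity in [Y]. *)
Fact sub_coactA w :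
  tassoc (tmap sub_coact id (sub_coact w)) = tmap id (comult C) (sub_coact w).
Proof.
apply: (flat_left_tensA flatC flatC k_inj).
transitivity (tmap id (comult C) (tmap k id (sub_coact w))); last first.
  move: (sub_coact w); apply: tensA_ext => [u v|u v|x c];
    rewrite ?(tmap_idD, id_comultD) //.
  by rewrite !(id_comultE, tmap_idE).
rewrite sub_coactE -coactA -sub_coactE; move: (sub_coact w).
apply: tensA_ext => [u v|u v|x c]; rewrite ?(tmap_idD, tassocD) //.
rewrite !tmap_idE /= -sub_coactE; move: (sub_coact x).
apply: tensA_ext => [u v|u v|y b]; rewrite ?(tmap_idD, pureADl, tassocD) //.
by rewrite !(tmap_idE, tassocE).
Qed.

Fact sub_coact1 w :
  tliftA (fun (x : W) (c : C) => x *r (counit C c : A)) (sub_coact w) = w.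
Proof.
pose b X := ract_counit_balanced C X.
apply: k_inj; rewrite -[RHS]coact1 -sub_coactE; move: (sub_coact w).
apply: tensA_ext => [u v|u v|y c].
- by rewrite (tliftAD (b _)) linearD.
- by rewrite tmap_idD (tliftAD (b _)).
by rewrite tmap_idE !(tliftAE _ _ (b _)) linearZ.
Qed.

Definition sub_comod : comodule C := Comodule sub_coactA sub_coact1.

Fact sub_inclP (w : sub_comod) : coact Y (k w) = tmap k id (coact sub_comod w).
Proof. exact/esym/sub_coactE. Qed.

Definition sub_incl : comod_hom sub_comod Y := ComodHom sub_inclP.

End Subcomodule.

Section QuotientComodule.
Variables (K : comPzRingType) (A : pzRingType) (eta : alg_struct K A).
Variables (C : coring eta) (Y : comodule C).
Variables (Q : lmodType A^c) (p : {linear Y -> Q}).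
Hypothesis p_surj : forall q, exists y, p y = q.
Hypothesis p_stable : forall y, p y = 0 -> tmap p id (coact Y y) = 0 :> tensA Q C.

Definition quot_coact (q : Q) : tensA Q C :=
  tmap p id (coact Y (projT1 (cid (p_surj q)))).

(** The chosen preimage is immaterial: it differs from [y] by an element of the kernel of [p], to
    which [p_stable] applies. *)
Lemma quot_coactE y : quot_coact (p y) = tmap p id (coact Y y).
Proof.
rewrite /quot_coact; case: cid => y' /= py'; apply/eqP; rewrite -subr_eq0.
rewrite -(linearB (tmapl C p)) -linearB /=; apply/eqP/p_stable.
by rewrite linearB py' subrr.
Qed.

Fact quot_coact_linear : linear quot_coact.
Proof.
move=> a x y; have [[u <-] [v <-]] := (p_surj x, p_surj y).
by rewrite -linearP !quot_coactE linearP [LHS](linearP (tmapl C p)).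
Qed.
HB.instance Definition _ := GRing.isLinear.Build A^c Q (tensA Q C) *:%R
  quot_coact quot_coact_linear.

Fact quot_coactA q :
  tassoc (tmap quot_coact id (quot_coact q)) = tmap id (comult C) (quot_coact q).
Proof.
have [y <-] := p_surj q; rewrite quot_coactE.
transitivity (tmap p id (tmap id (comult C) (coact Y y))); last first.
  move: (coact Y y); apply: tensA_ext => [u v|u v|x c];
    rewrite ?(tmap_idD, id_comultD) //.
  by rewrite !(id_comultE, tmap_idE).
rewrite -coactA; move: (coact Y y).
apply: tensA_ext => [u v|u v|x c]; rewrite ?(tmap_idD, tassocD) //.
rewrite !tmap_idE /= quot_coactE; move: (coact Y x).
apply: tensA_ext => [u v|u v|z b]; rewrite ?(tmap_idD, pureADl, tassocD) //.
by rewrite !(tmap_idE, tassocE).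
Qed.

Fact quot_coact1 q :
  tliftA (fun (x : Q) (c : C) => x *r (counit C c : A)) (quot_coact q) = q.
Proof.
pose b X := ract_counit_balanced C X.
have [y <-] := p_surj q; rewrite quot_coactE -[in RHS](coact1 y).
move: (coact Y y); apply: tensA_ext => [u v|u v|x c].
- by rewrite tmap_idD (tliftAD (b _)).
- by rewrite (tliftAD (b _)) linearD.
by rewrite tmap_idE !(tliftAE _ _ (b _)) linearZ.
Qed.

Definition quot_comod : comodule C := Comodule quot_coactA quot_coact1.

Definition quot_proj : comod_hom Y quot_comod :=
  @ComodHom _ _ _ C Y quot_comod p (fun y => quot_coactE y).

End QuotientComodule.

(** * Kernels, cokernels and exactness in the category of comodules *)

Section ComoduleExactness.
Variables (K : comPzRingType) (A : pzRingType) (eta : alg_struct K A).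
Variable C : coring eta.
Implicit Types W X Y Z Q : comodule C.

Lemma eq_tmap_id (M N : lmodType A^c) (D : bimodType eta) (f g : {linear M -> N})
    (u : tensA M D) :
  f =1 g -> tmap f id u = tmap g id u :> tensA N D.
Proof. by move=> /eq_linear ->. Qed.

Lemma comod_compE X Y Z (g : comod_hom Y Z) (f : comod_hom X Y) h :
  comod_comp g f = h -> forall x, g (f x) = h x.
Proof. by move=> <-. Qed.

Lemma comod_comp_eq0 X Y Z (g : comod_hom Y Z) (f : comod_hom X Y) :
  comod_comp g f = comod_zero X Z <-> forall x, g (f x) = 0.
Proof. by split=> [/comod_compE|gf0] //; apply: comod_homP. Qed.

(** As [g] is colinear, the coaction of [Y] sends [ker g] into the kernel of [g (x) C], which by
    right exactness is the image of [ker g (x) C]. Flatness then makes [ker g] a subcomodule. *)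
Lemma kernel_comod_exists Y Z (g : comod_hom Y Z) :
  flat_left C -> (forall z, exists y, g y = z) ->
  exists W (k : comod_hom W Y),
    injective k /\ forall y, g y = 0 <-> exists w, k w = y.
Proof.
move=> flatC gsurj; have kP := ker_inclP g.
have kst w : exists u : tensA (ker_mod g) C,
    tmap (ker_incl g) id u = coact Y (ker_incl g w).
  apply: (tmap_id_exact gsurj) => [y|]; first exact: (kP y).1.
  by rewrite -comod_funP (kP _).2 ?linear0 //; exists w.
exists _, (sub_incl flatC (@ker_incl_inj _ _ _ g) kst); split=> //.
exact: ker_incl_inj.
Qed.

Lemma cokernel_comod_exists X Y (f : comod_hom X Y) :
  exists Q (q : comod_hom Y Q),
    (forall z, exists y, q y = z) /\ forall y, q y = 0 <-> exists x, f x = y.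
Proof.
have pst y : coker_pi f y = 0 ->
    tmap (coker_pi f) id (coact Y y) = 0 :> tensA (coker_mod f) C.
  move=> /coker_pi_eq0[x <-]; rewrite comod_funP tmap_id_comp_lin.
  by apply: tmap_id_eq0 => z; apply/coker_pi_eq0; exists z.
exists _, (quot_proj (@coker_pi_surj _ _ _ f) pst); split.
  exact: coker_pi_surj.
exact: coker_pi_eq0.
Qed.

Lemma comod_lift W Y X (k : comod_hom W Y) (h : comod_hom X Y) :
  flat_left C -> injective k -> (forall x, exists w, k w = h x) ->
  exists u : comod_hom X W, comod_comp k u = h.
Proof.
move=> flatC kinj /choice[u ku].
have uP : linear u by move=> a x y; apply: kinj; rewrite linearP !ku linearP.
pose uL : {linear X -> W} := HB.pack u (GRing.isLinear.Build A^c X W *:%R u uP).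
have uC x : coact W (uL x) = tmap uL id (coact X x).
  apply: (flatC _ _ k kinj); rewrite -comod_funP tmap_id_comp_lin.
  rewrite (ku x : k (uL x) = h x) comod_funP.
  by apply: eq_tmap_id => z; rewrite /= ku.
by exists (ComodHom uC); apply: comod_homP => x; apply: ku.
Qed.

Lemma comod_factor Y Q Z (q : comod_hom Y Q) (h : comod_hom Y Z) :
  (forall z, exists y, q y = z) -> (forall y, q y = 0 -> h y = 0) ->
  exists u : comod_hom Q Z, comod_comp u q = h.
Proof.
move=> qsurj qh; have [s sK] := choice qsurj; pose u z := h (s z).
have uq y : u (q y) = h y.
  by apply/eqP; rewrite -subr_eq0 -linearB qh // linearB sK subrr.
have uP : linear u.
  move=> a x y; have [[x' <-] [y' <-]] := (qsurj x, qsurj y).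
  by rewrite -linearP !uq linearP.
pose uL : {linear Q -> Z} := HB.pack u (GRing.isLinear.Build A^c Q Z *:%R u uP).
have uC z : coact Z (uL z) = tmap uL id (coact Q z).
  have [y <-] := qsurj z.
  rewrite (uq y : uL (q y) = h y) !comod_funP tmap_id_comp_lin.
  by apply: eq_tmap_id => t; rewrite /= uq.
by exists (ComodHom uC); apply: comod_homP => y; apply: uq.
Qed.

Lemma is_kernelI W Y Z (k : comod_hom W Y) (g : comod_hom Y Z) :
  flat_left C -> injective k -> (forall y, g y = 0 <-> exists w, k w = y) ->
  is_kernel k g.
Proof.
move=> flatC kinj kerg; split=> [|X h /comod_comp_eq0 gh].
  by apply/comod_comp_eq0 => w; apply/kerg; exists w.
have [|u ku] := comod_lift flatC kinj (h := h); first by move=> x; apply/kerg.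
exists u; split=> // u' ku'; apply: comod_homP => x; apply: kinj.
by rewrite (comod_compE ku) (comod_compE ku').
Qed.

Lemma is_cokernelI X Y Q (f : comod_hom X Y) (q : comod_hom Y Q) :
  (forall z, exists y, q y = z) -> (forall y, q y = 0 <-> exists x, f x = y) ->
  is_cokernel q f.
Proof.
move=> qsurj kerq; split=> [|Z h /comod_comp_eq0 hf].
  by apply/comod_comp_eq0 => x; apply/kerq; exists x.
have [|u uq] := comod_factor qsurj (h := h); first by move=> y /kerq[x <-].
exists u; split=> // u' uq'; apply: comod_homP => z; have [y <-] := qsurj z.
by rewrite (comod_compE uq) (comod_compE uq').
Qed.

(** The projection onto the cokernel of [g] and the zero map agree after composition with [g], hence
    are equal, so every element lies in the image. *)
Lemma is_epi_surj Y Z (g : comod_hom Y Z) :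
  is_epi g -> forall z, exists y, g y = z.
Proof.
move=> epig z; have [Q [q [_ kerq]]] := cokernel_comod_exists g.
apply/kerq; suff -> : q = comod_zero Z Q by [].
apply: epig; apply: comod_homP => y /=; apply/kerq; by exists y.
Qed.

Lemma surj_is_epi Y Z (g : comod_hom Y Z) :
  (forall z, exists y, g y = z) -> is_epi g.
Proof.
move=> gsurj W h h' hh'; apply: comod_homP => z; have [y <-] := gsurj z.
exact: comod_compE hh' y.
Qed.

Lemma exact_atP X Y Z (f : comod_hom X Y) (g : comod_hom Y Z) :
  flat_left C -> (forall z, exists y, g y = z) ->
  exact_at f g <-> forall y, g y = 0 <-> exists x, f x = y.
Proof.
move=> flatC gsurj.
have [W0 [k0 [k0inj kerg]]] := kernel_comod_exists flatC gsurj.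
split=> [[W [Q [k [q [[qf cokq] [qk kerq] [gk kg]]]]]] y | kf]; last first.
  (* Being onto with kernel the image of [f], the map [g] itself serves as the cokernel of [f]. *)
  exists W0, Z, k0, g; split; first exact: is_cokernelI.
    exact: is_kernelI.
  exact: is_kernelI.
have [Q0 [q0 [_ kerq0]]] := cokernel_comod_exists f.
have [|u0 [uq _]] := cokq _ q0.
  by apply/comod_comp_eq0 => x; apply/kerq0; exists x.
have [|v [kv _]] := kg _ k0.
  by apply/comod_comp_eq0 => w; apply/kerg; exists w.
have [t [kt _]] := kerq _ f qf.
(* The abstract [k] and [q] are compared with the concrete [k0] and [q0]: [k0 = k v], [q0 = u0 q]
   and [f = k t]. Hence [q0 k0 = u0 q k v = 0], which puts [ker g] in the image of [f], and
   [g f = g k t = 0]. *)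
split=> [/kerg[w <-]|[x <-]].
  apply/kerq0; rewrite -(comod_compE kv) -(comod_compE uq).
  by have /comod_comp_eq0 -> := qk; rewrite linear0.
by rewrite -(comod_compE kt); have /comod_comp_eq0 := gk.
Qed.

End ComoduleExactness.

(** * Comodule maps into and out of direct sums *)

Section DirectSumMaps.
Variables (K : comPzRingType) (A : pzRingType) (eta : alg_struct K A).
Variables (C : coring eta) (I : choiceType) (S : comodule C).
Local Notation SI := (dsum_comod I S).

Fact dinj_comodP i x : coact SI (dinj i x) = tmap (dinj i) id (coact S x).
Proof. exact: dsum_coact_inj. Qed.
Definition dinj_hom i : comod_hom S SI :=
  @ComodHom _ _ _ C S SI (dinj i) (dinj_comodP i).

Definition dcoef_at (i : I) (s : dsum I S) : S := dcoef s i.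
Fact dcoef_at_linear i : linear (dcoef_at i).
Proof. by move=> a s t; rewrite /dcoef_at dcoef_add dcoef_scale. Qed.
HB.instance Definition _ i := GRing.isLinear.Build A^c (dsum I S) S *:%R
  (dcoef_at i) (dcoef_at_linear i).
Definition dcoef_lin i : {linear dsum I S -> S} := dcoef_at i.

Fact dcoef_comodP i (s : SI) :
  coact S (dcoef_lin i s) = tmap (dcoef_lin i) id (coact SI s).
Proof.
move: s; apply: dsum_ext => [s t|s t|j x].
- by rewrite !linearD.
- by rewrite linearD tmap_idD.
have E y : dcoef_lin i (dinj j y) = if i == j then y else 0 by exact: dcoef_inj.
rewrite dinj_comodP tmap_id_comp_lin E; case: (i == j) E => E; last first.
  by rewrite linear0 tmap_id_eq0.
rewrite (eq_tmap_id (g := idfun)) //; move: (coact S x).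
by apply: tensA_ext => [u v|u v|y c] //; rewrite ?tmap_idD ?tmap_idE.
Qed.
Definition dcoef_hom i : comod_hom SI S := ComodHom (dcoef_comodP i).

Lemma dlift_comod_exists Z (F : I -> comod_hom S Z) :
  exists g : comod_hom SI Z, forall i x, g (dinj i x) = F i x.
Proof.
pose g : dsum I S -> Z := dlift (fun i => F i).
have FD i : {morph F i : x y / x + y} by exact: linearD.
have gE i x : g (dinj i x) = F i x := dlift_inj FD i x.
have gD : {morph g : s t / s + t} := dliftD FD.
have gP : linear g.
  move=> a s t; rewrite gD; congr (_ + _).
  move: s; apply: dsum_ext => [x y|x y|i x]; rewrite ?(scalerDr, gD) //.
  by rewrite -linearZ !gE linearZ.
pose gL : {linear SI -> Z} := HB.pack g
  (GRing.isLinear.Build A^c (dsum I S) Z *:%R g gP).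
have gC s : coact Z (gL s) = tmap gL id (coact SI s).
  move: s; apply: dsum_ext => [s t|s t|i x].
  - by rewrite !linearD.
  - by rewrite linearD tmap_idD.
  rewrite dinj_comodP tmap_id_comp_lin (gE i x : gL (dinj i x) = F i x).
  by rewrite comod_funP; apply: eq_tmap_id => y /=; rewrite gE.
by exists (ComodHom gC).
Qed.

(** The union of the supports of the images of finitely many generators suffices, since an index
    outside it has zero coefficient on every linear combination. *)
Lemma dsum_common_support (h : {linear S -> dsum I S}) :
  fin_gen S -> exists T : {fset I}, forall x, (finsupp (h x) `<=` T)%fset.
Proof.
move=> [n [e genS]].
exists [fset i in flatten [seq (finsupp (h (e a)) : seq I) | a <- enum 'I_n]]%fset.
move=> x.
apply/fsubsetP => i; rewrite mem_finsupp; apply: contraNT; rewrite !inE /= => iT.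
have [r ->] := genS x; rewrite linear_sum; apply/eqP.
transitivity (dcoef_lin i (\sum_a h (e a *r r a))) => //.
rewrite linear_sum big1 // => a _; rewrite !linearZ /= -[X in _ *: X]/(h (e a) i).
rewrite fsfun_dflt ?scaler0 //; apply: contra iT => ia.
by apply/flatten_mapP; exists a; rewrite ?mem_enum.
Qed.

End DirectSumMaps.

Section HomGroup.
Variables (K : comPzRingType) (A : pzRingType) (eta : alg_struct K A).
Variables (C : coring eta) (X Y : comodule C).

Fact comod_subP (f g : comod_hom X Y) x :
  coact Y ((f \- g) x) = tmap (f \- g) id (coact X x).
Proof.
rewrite /= linearB /= !comod_funP; apply/eqP; rewrite subr_eq; apply/eqP.
move: (coact X x); apply: tensA_ext => [u v|u v|y c].
- exact: tmap_idD.
- by rewrite !tmap_idD addrACA.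
by rewrite !tmap_idE -pureADl /= subrK.
Qed.
Definition comod_sub (f g : comod_hom X Y) : comod_hom X Y :=
  ComodHom (comod_subP f g).

End HomGroup.

(** * Comodule maps to the coring and linear forms *)

Section HomToCoring.
Variables (K : comPzRingType) (A : pzRingType) (eta : alg_struct K A).
Variables (C : coring eta) (S : comodule C).

Definition counit_form (M : lmodType A^c) (h : {linear M -> C}) : rdual M :=
  (counit C : {linear C -> (A^c)^o}) \o h.

(** By the left counit law and colinearity, [h(x) = eps(h(x)_1) h(x)_2 = eps(h(x_0)) x_1]. So [h] is
    recovered from [eps \o h]. *)
Lemma comod_hom_canE (h : comod_hom S (coring_comod C)) x :
  h x = can (cpure (counit_form h) x).
Proof.
have b : balancedA (fun x y : C => (counit C x : A) *l y).
  split=> [c c' d|c d d'|c a d]; rewrite ?lactDr //.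
    by rewrite linearD lactDl.
  by rewrite linearZ lactA.
rewrite can_pure -[LHS]counitl [comult C _](comod_funP h x).
move: (coact S x); apply: tensA_ext => [u v|u v|y c].
- by rewrite tmap_idD (tliftAD b).
- exact: ev_lactD.
by rewrite tmap_idE (tliftAE _ _ b) ev_lactE.
Qed.

Definition can_form (phi : rdual S) (x : S) : C := can (cpure phi x).
Fact can_form_linear phi : linear (can_form phi).
Proof. by move=> a x y; rewrite /can_form cpureDr canD -cpure_ract can_ract. Qed.
HB.instance Definition _ phi := GRing.isLinear.Build A^c S C *:%R
  (can_form phi) (can_form_linear phi).
Definition can_form_lin (phi : rdual S) : {linear S -> C} := can_form phi.

(** Left linearity of the comultiplication and coassociativity send [phi(x_0) x_1] to
    [phi(x_0) x_1 (x) x_2]. *)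
Fact can_form_comodP phi x :
  coact (coring_comod C) (can_form_lin phi x) =
  tmap (can_form_lin phi) id (coact S x).
Proof.
transitivity (ev_lact phi (tmap id (comult C) (coact S x))).
  rewrite [LHS]/= /can_form can_pure; move: (coact S x).
  apply: tensA_ext => [u v|u v|y c].
  - by rewrite ev_lactD linearD.
  - by rewrite id_comultD ev_lactD.
  by rewrite id_comultE !ev_lactE comult_lact.
rewrite -coactA; move: (coact S x); apply: tensA_ext => [u v|u v|y c].
- by rewrite tmap_idD tassocD ev_lactD.
- exact: tmap_idD.
rewrite !tmap_idE /= /can_form can_pure; move: (coact S y).
apply: tensA_ext => [u v|u v|z b].
- by rewrite pureADl tassocD ev_lactD.
- by rewrite ev_lactD pureADl.
by rewrite tassocE !ev_lactE lact_pureA.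
Qed.
Definition can_form_hom phi : comod_hom S (coring_comod C) :=
  ComodHom (can_form_comodP phi).

Lemma counit_can_form phi : counit_form (can_form_hom phi) = phi.
Proof.
by apply: rdualP => x; rewrite [LHS]can_counit comatrix_counitE.
Qed.

Variable I : choiceType.

(** This is [theta], written for any form [psi] on [S^(I)]; its components [phi_i] are the
    restrictions of [psi] to the summands. *)
Definition cpure_dsum (psi : rdual (dsum I S)) : dsum I S -> comatrix S :=
  dlift (fun i => cpure ((psi : {linear dsum I S -> (A^c)^o}) \o dinj i)).

Let cpureD (psi : rdual (dsum I S)) i :
  {morph cpure ((psi : {linear dsum I S -> (A^c)^o}) \o dinj i) : x y / x + y}.
Proof. exact: cpureDr. Qed.

Lemma cpure_dsumD psi : {morph cpure_dsum psi : s t / s + t}.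
Proof. exact: dliftD. Qed.

Lemma cpure_dsum_inj (psi : rdual (dsum I S)) i x :
  cpure_dsum psi (dinj i x) =
  cpure ((psi : {linear dsum I S -> (A^c)^o}) \o dinj i) x.
Proof. exact: dlift_inj. Qed.

(* [S] being finitely generated, [h] has only finitely many nonzero           *)
(* components [t_i], and [psi \o h] is the sum of the [psi_i t_i].            *)
Lemma cpure_dsum_hom (psi : rdual (dsum I S))
    (h : comod_hom S (dsum_comod I S)) x :
  fin_gen S ->
  cpure_dsum psi (h x) = cpure ((psi : {linear dsum I S -> (A^c)^o}) \o h) x.
Proof.
move=> fgS; have [T hT] := dsum_common_support h fgS.
pose F i := (psi : {linear dsum I S -> (A^c)^o}) \o dinj i.
pose t i : endo S := comod_comp (dcoef_hom S i) h.
rewrite [LHS](dlift_incl (cpureD psi) (hT x)).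
transitivity (\sum_(i <- T) cpure (rdual_endo (F i) (t i)) x).
  by apply: eq_bigr => i _; rewrite cpure_mid.
rewrite -(morph_sum _ _ (fun u v => cpureDl u v x)); congr cpure.
apply: rdualP => y; rewrite (morph_sum _ _ (fun u v => evDl u v y)).
have FD i : {morph F i : x y / x + y} by exact: linearD.
have psiE : psi =1 dlift F.
  apply: dsum_ext => [u v|u v|i z]; first exact: linearD.
    exact: (dliftD FD).
  by rewrite (dlift_inj FD).
rewrite [RHS]/(ev _ _) /= psiE (dlift_incl FD (hT y)).
by apply: eq_bigr.
Qed.

Lemma can_cpure_dsum (g : comod_hom (dsum_comod I S) (coring_comod C)) s :
  can (cpure_dsum (counit_form g) s) = g s.
Proof.
move: s; apply: dsum_ext => [s t|s t|i x].
- by rewrite cpure_dsumD canD.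
- exact: linearD.
rewrite cpure_dsum_inj.
apply: etrans (esym (comod_hom_canE (comod_comp g (dinj_hom S i)) x)).
by congr (can (cpure _ x)); apply: rdualP.
Qed.

End HomToCoring.

(** * Bijectivity of [can] and presentations of [C] by copies of [S] *)

Section Galois.
Variables (K : comPzRingType) (A : pzRingType) (eta : alg_struct K A).
Variables (C : coring eta).

Lemma bij_coring_iso (B D : coring eta) (f : B -> D) :
  coring_hom f -> injective f -> (forall y, exists x, f x = y) -> coring_iso f.
Proof.
move=> fH finj fsurj; have [fD fl fr fc fe] := fH.
have [g gK] := choice fsurj; have fK x : g (f x) = x by apply: finj; rewrite gK.
have gD : {morph g : x y / x + y} by move=> x y; apply: finj; rewrite fD !gK.
have gl a x : g (a *l x) = a *l g x by apply: finj; rewrite fl !gK.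
have gr (a : A) x : g (x *r a) = g x *r a by apply: finj; rewrite fr !gK.
split=> //; exists g; split=> //; split=> // y; last first.
  by rewrite -{2}(gK y) fe.
pose fL : {linear B -> D} := HB.pack f
  (GRing.isNmodMorphism.Build _ _ f (morphD0 fD, fD))
  (GRing.isScalable.Build A^c _ _ *:%R f (fun a x => fr a x)).
pose gL : {linear D -> B} := HB.pack g
  (GRing.isNmodMorphism.Build _ _ g (morphD0 gD, gD))
  (GRing.isScalable.Build A^c _ _ *:%R g (fun a x => gr a x)).
rewrite -{2}(gK y) fc; move: (comult B (g y)).
apply: (@tensA_ext _ _ _ _ _ _ id) => [u v|u v|x z] //.
  by rewrite (tmapD fL fD fl) (tmapD gL gD gl).
by rewrite (tmapE fL _ _ fD fl) (tmapE gL _ _ gD gl) /= !fK.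
Qed.

Variable S : comodule C.
Hypotheses (fgS : fin_gen S) (projS : projective S).

Lemma galoisP :
  galois fgS projS <->
  injective (@can K A eta C S) /\ forall c, exists u : comatrix S, can u = c.
Proof.
split=> [[_ [g [_ gK Kg]]]|[inj surj]].
  by split=> [|c]; [exact: can_inj gK | exists (g c)].
exact: (@bij_coring_iso (comatrix_coring _) C _ (can_coring_hom _) inj surj).
Qed.

Lemma hom_exact_bij_can (I J : choiceType)
    (f : comod_hom (dsum_comod J S) (dsum_comod I S))
    (g : comod_hom (dsum_comod I S) (coring_comod C)) :
  (forall c, exists s, g s = c) ->
  (forall s, g s = 0 <-> exists t, f t = s) ->
  (forall h : comod_hom S (coring_comod C), exists h', comod_comp g h' = h) ->
  injective (@can K A eta C S) /\ forall c, exists u : comatrix S, can u = c.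
Proof.
move=> gsurj kerg lift.
pose theta := cpure_dsum (counit_form g).
have canth s : can (theta s) = g s by exact: can_cpure_dsum.
have thE h x := cpure_dsum_hom (counit_form g) h x fgS.
have thD : {morph theta : s t / s + t} := cpure_dsumD _.
have thf t : theta (f t) = 0.
  move: t; apply: dsum_ext => [s t|s t|j x]; first by rewrite linearD thD.
    by rewrite addr0.
  (* On the [j]-th summand, [theta \o f] sends [x] to [(eps \o g \o f \o dinj j) (x) x], which
     vanishes because [g \o f] does. *)
  rewrite [LHS](thE (comod_comp f (dinj_hom S j))).
  rewrite -[RHS](morphD0 (fun u v => cpureDl u v x)); congr cpure.
  have gf0 y : g (f (dinj j y)) = 0 by apply/kerg; exists (dinj j y).
  by apply: rdualP => y; apply: etrans (congr1 (counit C) (gf0 y)) (linear0 _).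
have thsurj u : exists s, theta s = u.
  move: u; apply: tens_ind => [|phi x|u v [s <-] [t <-]].
  - by exists 0; apply: morphD0.
  (* Lifting [can (phi (x) -)] along [g] to [h'] gives [theta (h' x) = (eps \o g \o h') (x) x = phi
     (x) x]. *)
  - have [h' gh'] := lift (can_form_hom phi); exists (h' x).
    rewrite [LHS]thE; congr cpure; rewrite -[RHS]counit_can_form.
    by apply: rdualP => y; rewrite -gh'.
  - by exists (s + t).
split=> [u v uv|c]; last by have [s <-] := gsurj c; exists (theta s).
have [s sE] := thsurj (u - v); apply/eqP; rewrite -subr_eq0 -sE.
suff /kerg[t <-] : g s = 0 by rewrite thf.
by rewrite -canth sE; apply: (addIr (can v)); rewrite -canD subrK add0r.
Qed.

Lemma bij_can_hom_exact :
  injective (@can K A eta C S) -> (forall c, exists u : comatrix S, can u = c) ->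
  exists (I J : choiceType)
         (f : comod_hom (dsum_comod J S) (dsum_comod I S))
         (g : comod_hom (dsum_comod I S) (coring_comod C)),
  [/\ forall c, exists s, g s = c, forall s, g s = 0 <-> exists t, f t = s
    & hom_right_exact S f g].
Proof.
(* Every form is used as a generator, and [g] has [can (phi (x) -)] as its component at [phi]. Each
   comodule map from [S] to [C] is thus a component of [g], which makes [Hom_C(S, g)] onto. *)
move=> caninj cansurj; pose I : choiceType := rdual S.
have [g gE] := dlift_comod_exists (I := I) (@can_form_hom _ _ _ C S).
(* All relations among these generators are indexed. A map [h] killed by [g] is then itself a
   component of [f], which gives exactness of the Hom groups in the middle. *)
pose rel := {h : comod_hom S (dsum_comod I S) | comod_comp g h = comod_zero _ _}.
pose J : choiceType := HB.pack rel (gen_eqMixin rel) (gen_choiceMixin rel).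
have [f fE] := dlift_comod_exists (fun j : J => sval (j : rel)).
have gf t : g (f t) = 0.
  move: t; apply: dsum_ext => [s t|s t|[h gh] x]; first by rewrite !linearD.
    by rewrite addr0.
  by rewrite fE /=; apply: (comod_compE gh).
have kf (h : comod_hom S (dsum_comod I S)) x :
    (forall y, g (h y) = 0) -> exists t, f t = h x.
  move=> /comod_comp_eq0 gh; exists (dinj (exist _ h gh : J) x).
  by rewrite fE.
pose theta := cpure_dsum (counit_form g).
have canth s : can (theta s) = g s by exact: can_cpure_dsum.
have thD : {morph theta : s t / s + t} := cpure_dsumD _.
have thE phi x : theta (dinj (phi : I) x) = cpure phi x.
  rewrite [LHS]cpure_dsum_inj; congr cpure; rewrite -[RHS]counit_can_form.
  by apply: rdualP => y; rewrite /ev /=; apply: (congr1 (counit C) (gE phi y)).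
(* [F] induces a map from [S^* (x)_T S] to the cokernel of [f] whose composite with [theta] is the
   projection, so the kernel of [theta] lies in the image of [f]. *)
pose F (phi : rdual S) x := coker_pi f (dinj (phi : I) x).
have bF : cbalanced F.
  split=> [phi psi x|phi x y|phi t x]; rewrite /F.
  - rewrite -linearD; apply/coker_pi_eqP.
    (* The defect of additivity in the form, as a comodule map [S -> S^(I)]. As [can] respects the
       relations of the tensor product, [g] kills it, so its values lie in the image of [f]; the
       [T]-balancing relation below is treated alike. *)
    pose h := comod_sub (comod_sub (dinj_hom S (phi + psi : I)) (dinj_hom S (phi : I)))
      (dinj_hom S (psi : I)).
    have [|t ft] := kf h x; last by exists t; rewrite ft opprD addrA.
    move=> y; rewrite /= !linearB !gE /= /can_form cpureDl canD.
    by rewrite addrAC addrK subrr.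
  - by rewrite !linearD.
  - apply/coker_pi_eqP.
    pose h := comod_sub (dinj_hom S (rdual_endo phi t : I))
      (comod_comp (dinj_hom S (phi : I)) t).
    have [|u fu] := kf h x; last by exists u.
    by move=> y; rewrite /= linearB !gE /= /can_form cpure_mid subrr.
have Fth s : clift F (theta s) = coker_pi f s.
  move: s; apply: dsum_ext => [s t|s t|phi x].
  - by rewrite thD (cliftD bF).
  - exact: linearD.
  by rewrite thE cliftE.
exists I, J, f, g; split.
- move=> c; have [u <-] := cansurj c.
  move: u; apply: tens_ind => [|phi x|u v [s gs] [t gt]].
  + by exists 0; rewrite linear0 (morphD0 (@canD _ _ _ C S)).
  + by exists (dinj (phi : I) x); rewrite gE.
  + by exists (s + t); rewrite linearD gs gt canD.
(* Injectivity of [can] enters here: [g s = can (theta s)], so [g s = 0] forces [theta s = 0]. *)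
- move=> s; split=> [gs|[t <-]] //; apply/(coker_pi_eq0 f); rewrite -Fth.
  have -> : theta s = 0; last exact: (morphD0 (cliftD bF)).
  by apply: caninj; rewrite canth gs (morphD0 (@canD _ _ _ C S)).
split=> h.
  split=> [gh|[h' <-]]; last by apply/comod_comp_eq0 => x; apply: gf.
  exists (dinj_hom S (exist _ h gh : J)); apply: comod_homP => x.
  exact: fE.
exists (dinj_hom S (counit_form h : I)); apply: comod_homP => x.
by rewrite [RHS]comod_hom_canE; apply: gE.
Qed.

End Galois.

Theorem theorem1p5 (K : comPzRingType) (A : pzRingType) (eta : alg_struct K A)
    (C : coring eta) (S : comodule C)
    (fgS : fin_gen S) (projS : projective S) (flatC : flat_left C) :
  galois fgS projS <->
  exists (I J : choiceType)
         (f : comod_hom (dsum_comod J S) (dsum_comod I S))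
         (g : comod_hom (dsum_comod I S) (coring_comod C)),
    right_exact_seq f g /\ hom_right_exact S f g.
Proof.
split=> [/galoisP[caninj cansurj]|[I [J [f [g [[exfg epig] [_ lift]]]]]]].
  have [I [J [f [g [gsurj kerg homex]]]]] := bij_can_hom_exact caninj cansurj.
  exists I, J, f, g; split=> //; split; first exact/exact_atP.
  exact: surj_is_epi.
have gsurj := is_epi_surj epig; apply/galoisP.
exact: (hom_exact_bij_can fgS gsurj ((exact_atP f flatC gsurj).1 exfg) lift).
Qed.
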